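(* Let $V$ be a JB-algebra with positive cone $\Omega$, let $p\in\Omega$ and $v\in V$. The geodesic $\Lambda_t=U_pe^{tL_v}$, $t\in[0,1]$, is minimizing in $G(\Omega)$, i.e. $$\mathrm{Length}_{G(\Omega)}(\Lambda)=\|L_v\|=\|v\|=\mathrm{dist}_{G(\Omega)}(\Lambda_0,\Lambda_1)=\mathrm{dist}_{G(\Omega)}(U_p,U_pe^{L_v}).$$
   Context: A JB-algebra is a real Banach space $V$ with a bilinear commutative product $\circ$ and unit $1$ such that $x^2\circ(x\circ y)=x\circ(x^2\circ y)$, $\|x\circ y\|\le\|x\|\|y\|$, $\|x^2\|=\|x\|^2$ and $\|x^2\|\le\|x^2+y^2\|$. $L_xy=x\circ y$, $U_x=2L_x^2-L_{x^2}$. $\Omega$ is the open convex cone of elements with spectrum in $(0,\infty)$. $B(V)$ is the algebra of bounded operators with operator norm $\|\cdot\|$. $G(\Omega)$ is the group of invertible $g\in B(V)$ with $g(\Omega)=\Omega$; it is an embedded Banach-Lie subgroup of the group of invertible elements of $B(V)$, with Lie algebra $\mathfrak{str}(V)=\{L_x:x\in V\}\oplus\mathrm{Der}(V)$, where $\mathrm{Der}(V)$ is the space of bounded derivations of $V$. Its Finsler norm is $\|H\|_g=\|g^{-1}H\|$ for $H\in T_gG(\Omega)=g\,\mathfrak{str}(V)$; $\mathrm{Length}_{G(\Omega)}(\alpha)=\int\|\alpha_t^{-1}\alpha_t'\|\,dt$ for piecewise $C^1$ paths, and $\mathrm{dist}_{G(\Omega)}$ is the infimum of lengths of piecewise $C^1$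 paths in $G(\Omega)$ joining the points. The path $\Lambda$ is a geodesic of the connection on $G(\Omega)$ induced by the left-invariant quadratic spray $F_g(gH)=g(H^2+H^\dagger H-HH^\dagger)$, $(L_x+D)^\dagger=L_x-D$. *)

(* Defs.v *)
From HB Require Import structures.
From mathcomp Require Import all_boot all_order all_algebra.
From mathcomp Require Import all_classical all_reals all_analysis.

Set Implicit Arguments.
Unset Strict Implicit.
Unset Printing Implicit Defensive.

Import Order.TTheory GRing.Theory Num.Theory.
Import numFieldNormedType.Exports.

Local Open Scope ring_scope.
Local Open Scope classical_set_scope.

(******************************************************************************)
(*        bop V == B(V), a normed module for the operator norm and a ring for *)
(*                 composition; the ring is zero when V is, whence a pzRing   *)
(*   jbAlgType R == unital JB-algebras over R : realType                      *)
(*        jcone == the open cone Omega; GOmega == the group G(Omega)          *)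
(******************************************************************************)

Section BoundedOperators.
Context {R : realType} {V : normedModType R}.

Definition bounded_op (f : V -> V) : Prop :=
  linear f /\ exists M : R, forall x, `|f x| <= M * `|x|.

Definition bounded_op_pred : {pred V -> V} := [pred f | `[< bounded_op f >]].

Record bop := Bop {
  bop_fun :> V -> V ;
  bop_subproof : bounded_op_pred bop_fun }.

HB.instance Definition _ := [isSub for bop_fun].
HB.instance Definition _ := [Choice of bop by <:].

Lemma bop_bounded (T : bop) : bounded_op T.
Proof. by case: T => f /= /asboolP. Qed.

Lemma bopP (S T : bop) : S =1 T -> S = T.
Proof. by move=> ST; apply/val_inj/funext. Qed.

Definition mk_bop (f : V -> V) (hf : bounded_op f) : bop :=
  Bop (introT (asboolP _) hf).

Lemma bounded_op_submod : submod_closed bounded_op_pred.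
Proof.
split=> [|a f g].
  apply/asboolP; split=> [c x y /=|].
    by rewrite scaler0 addr0.
  by exists 0 => x; rewrite normr0 mul0r.
move=> /asboolP[lf [M hM]] /asboolP[lg [N hN]]; apply/asboolP; split.
  move=> c x y; rewrite /= (_ : forall z, (a *: f + g) z = a *: f z + g z)//.
  rewrite !(_ : forall z, (a *: f + g) z = a *: f z + g z)// lf lg.
  by rewrite !scalerDr !scalerA (mulrC a c) addrACA.
exists (`|a| * M + N) => x; rewrite mulrDl.
rewrite (le_trans (ler_normD _ _))// lerD//.
by rewrite normrZ -mulrA ler_wpM2l.
Qed.

HB.instance Definition _ :=
  GRing.isSubmodClosed.Build R (V -> V) bounded_op_pred bounded_op_submod.
HB.instance Definition _ := [SubChoice_isSubLmodule of bop by <:].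

Lemma bopD (S T : bop) x : (S + T) x = S x + T x. Proof. by []. Qed.
Lemma bopZ a (T : bop) x : (a *: T) x = a *: T x. Proof. by []. Qed.

Lemma bop_linear (T : bop) : linear T.
Proof. by case: (bop_bounded T). Qed.

Lemma bop_fun0 (T : bop) : T 0 = 0.
Proof.
have := bop_linear T 1 0 0; rewrite !scale1r addr0 => /eqP.
by rewrite -subr_eq0 opprD addrA subrr sub0r oppr_eq0 => /eqP.
Qed.

Lemma bop_funD (T : bop) x y : T (x + y) = T x + T y.
Proof. by have := bop_linear T 1 x y; rewrite !scale1r. Qed.

Lemma bop_funZ (T : bop) a x : T (a *: x) = a *: T x.
Proof. by have := bop_linear T a x 0; rewrite !addr0 bop_fun0 addr0. Qed.

Lemma bounded_op_id : bounded_op (@id V).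
Proof. by split=> //; exists 1 => x; rewrite mul1r. Qed.

Lemma bounded_op_comp (S T : bop) : bounded_op (S \o T).
Proof.
split=> [a x y /=|]; first by rewrite !bop_linear.
have [_ [M hM]] := bop_bounded S; have [_ [N hN]] := bop_bounded T.
exists (`|M| * `|N|) => x /=; rewrite (le_trans (hM _))// -mulrA.
rewrite (le_trans (ler_wpM2r _ (ler_norm M)))// ler_wpM2l//.
by rewrite (le_trans (hN _))// ler_wpM2r// ler_norm.
Qed.

Definition bop1 : bop := mk_bop bounded_op_id.
Definition bopM (S T : bop) : bop := mk_bop (bounded_op_comp S T).

Fact bopMA : associative bopM. Proof. by move=> S T U; apply: bopP. Qed.
Fact bop1M : left_id bop1 bopM. Proof. by move=> S; apply: bopP. Qed.
Fact bopM1 : right_id bop1 bopM. Proof. by move=> S; apply: bopP. Qed.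
Fact bopMDl : left_distributive bopM +%R.
Proof. by move=> S T U; apply: bopP. Qed.
Fact bopMDr : right_distributive bopM +%R.
Proof. by move=> S T U; apply: bopP => x; rewrite /= bop_funD. Qed.

HB.instance Definition _ :=
  GRing.Zmodule_isPzRing.Build bop bopMA bop1M bopM1 bopMDl bopMDr.

Definition opnorm (T : bop) : R := sup [set `|T x| | x in [set x | `|x| <= 1]].

Lemma opnorm_has_sup (T : bop) : has_sup [set `|T x| | x in [set x | `|x| <= 1]].
Proof.
split; first by exists `|T 0|; exists 0 => //=; rewrite normr0.
have [_ [M hM]] := bop_bounded T.
exists `|M| => _ [x /= x1 <-]; rewrite (le_trans (hM x))//.
rewrite (le_trans (ler_wpM2r _ (ler_norm M)))//.
by rewrite -[leRHS]mulr1 ler_wpM2l.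
Qed.

Lemma opnorm_ubound (T : bop) x : `|T x| <= opnorm T * `|x|.
Proof.
have [->|x0] := eqVneq x 0; first by rewrite bop_fun0 !normr0 mulr0.
have nx0 : 0 < `|x| by rewrite normr_gt0.
rewrite -ler_pdivrMr// mulrC -[X in X * _](@ger0_norm _ `|x|^-1) ?invr_ge0//.
rewrite -normrZ -bop_funZ; apply: (ub_le_sup (opnorm_has_sup T).2).
by exists (`|x|^-1 *: x) => //=; rewrite normrZ ger0_norm ?invr_ge0// mulVf// gt_eqF.
Qed.

Lemma opnorm_le (T : bop) (M : R) :
  (forall x, `|x| <= 1 -> `|T x| <= M) -> opnorm T <= M.
Proof.
move=> hM; apply: ge_sup; first exact: (opnorm_has_sup T).1.
by move=> _ [x /= x1 <-]; exact: hM.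
Qed.

Lemma opnorm_ge0 (T : bop) : 0 <= opnorm T.
Proof.
apply: (le_trans (normr_ge0 (T 0))); apply: (ub_le_sup (opnorm_has_sup T).2).
by exists 0 => //=; rewrite normr0.
Qed.

Fact opnormD (S T : bop) : opnorm (S + T) <= opnorm S + opnorm T.
Proof.
apply: opnorm_le => x x1; rewrite bopD (le_trans (ler_normD _ _))// lerD//.
- by apply: (ub_le_sup (opnorm_has_sup S).2); exists x.
- by apply: (ub_le_sup (opnorm_has_sup T).2); exists x.
Qed.

Fact opnormZ (a : R) (T : bop) : opnorm (a *: T) = `|a| * opnorm T.
Proof.
have le b (S : bop) : opnorm (b *: S) <= `|b| * opnorm S.
  apply: opnorm_le => x x1; rewrite bopZ normrZ ler_wpM2l//.
  by apply: (ub_le_sup (opnorm_has_sup S).2); exists x.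
apply/le_anti/andP; split; first exact: le.
have [->|a0] := eqVneq a 0; first by rewrite normr0 mul0r opnorm_ge0.
rewrite -{1}[T](scalerK a0) -ler_pdivlMl ?normr_gt0// -normfV.
exact: le.
Qed.

Fact opnorm_eq0 (T : bop) : opnorm T = 0 -> T = 0.
Proof.
move=> T0; apply: bopP => x; apply/normr0_eq0/le_anti.
by rewrite normr_ge0 andbT (le_trans (opnorm_ubound T x))// T0 mul0r.
Qed.

HB.instance Definition _ :=
  Lmodule_isNormed.Build R bop opnormD opnormZ opnorm_eq0.

Lemma bop_normE (T : bop) : `|T| = opnorm T. Proof. by []. Qed.

Definition bop_is_inverse (T S : bop) : Prop := T * S = 1 /\ S * T = 1.

Definition bop_invertible (T : bop) : Prop := exists S, bop_is_inverse T S.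

(* the inverse of T in B(V); an arbitrary operator if T is not invertible *)
Definition bop_inv (T : bop) : bop := get (bop_is_inverse T).

Definition bop_exp (T : bop) : bop :=
  limn (series (fun n : nat => n`!%:R^-1 *: T ^+ n)).

End BoundedOperators.
Arguments bop {R} V.

HB.mixin Record CompleteNormedModule_isJBAlgebra (R : realType) V
    & CompleteNormedModule R V := {
  jmul : V -> V -> V ;
  junit : V ;
  jmulC : forall x y, jmul x y = jmul y x ;
  jmul_linear : forall y, linear (jmul ^~ y) ;
  jmul1 : forall x, jmul junit x = x ;
  jmul_jordan : forall x y,
    jmul (jmul x x) (jmul x y) = jmul x (jmul (jmul x x) y) ;
  jmul_norm : forall x y, `|jmul x y| <= `|x| * `|y| ;
  jmul_norm_sqr : forall x, `|jmul x x| = `|x| ^+ 2 ;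
  jmul_norm_sqrD : forall x y, `|jmul x x| <= `|jmul x x + jmul y y|
}.

#[short(type="jbAlgType")]
HB.structure Definition JBAlgebra (R : realType) :=
  {V of CompleteNormedModule R V & CompleteNormedModule_isJBAlgebra R V}.

Section JBAlgebraTheory.
Context {R : realType} {V : jbAlgType R}.

Lemma jmul_bounded_op (x : V) : bounded_op (jmul x).
Proof.
split; last by exists `|x| => y; exact: jmul_norm.
by move=> a y z; rewrite !(jmulC x) jmul_linear.
Qed.

Definition L_ (x : V) : bop V := mk_bop (jmul_bounded_op x).

Definition U_ (x : V) : bop V := 2 *: L_ x ^+ 2 - L_ (jmul x x).

Definition jinvertible (x : V) : Prop :=
  exists y, jmul x y = junit /\ jmul (jmul x x) y = x.

(* The spectrum of an element of a JB-algebra is real, so that only real      *)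
(* scalars need to be considered.                                             *)
Definition jspectrum (x : V) : set R :=
  [set l | ~ jinvertible (x - l *: junit)].

Definition jcone : set V := [set x | jspectrum x `<=` [set l | 0 < l]].

Definition derivation (D : bop V) : Prop :=
  forall x y, D (jmul x y) = jmul (D x) y + jmul x (D y).

Definition GOmega : set (bop V) :=
  [set g | bop_invertible g /\ g @` jcone = jcone].

(* F_g (g H) = g (H^2 + H^+ H - H H^+) for H = L_x + D, H^+ = L_x - D *)
Definition spray_value (g : bop V) (x : V) (D : bop V) : bop V :=
  let H := L_ x + D in
  let Hd := L_ x - D in
  g * (H ^+ 2 + Hd * H - H * Hd).

(* alpha is a curve in G(Omega) solving alpha'' = F_alpha(alpha') on I, with  *)
(* alpha' = alpha (L_x + D) in the tangent space alpha str(V)                 *)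
Definition spray_geodesic (I : set R) (alpha : R -> bop V) : Prop :=
  forall t, I t ->
    [/\ GOmega (alpha t),
        \forall s \near t, derivable alpha s 1,
        derivable alpha^`() t 1 &
        exists x D, [/\ derivation D,
          alpha^`() t = alpha t * (L_ x + D) &
          alpha^`()^`() t = spray_value (alpha t) x D]].

End JBAlgebraTheory.

Section Paths.
Context {R : realType} {W : normedModType R}.

(* alpha restricted to [a, b] is C^1: it is continuous and its derivative on  *)
(* ]a, b[ extends continuously to [a, b] (equivalently, alpha is C^1 on       *)
(* [a, b] with one-sided derivatives at the end points)                       *)
Definition C1_on (a b : R) (alpha : R -> W) : Prop :=
  {within `[a, b], continuous alpha} /\
  exists2 beta : R -> W, {within `[a, b], continuous beta} &
    forall t, t \in `]a, b[ -> derivable alpha t 1 /\ alpha^`() t = beta t.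

Definition piecewise_C1 (a b : R) (alpha : R -> W) : Prop :=
  exists2 s : seq R, itv_partition a b s &
    forall i, (i < size s)%N -> C1_on (nth b (a :: s) i) (nth b s i) alpha.

End Paths.

Section Distance.
Context {R : realType} {V : jbAlgType R}.

Definition finsler_norm (g H : bop V) : R := `|bop_inv g * H|.

Definition speed (alpha : R -> bop V) (t : R) : R :=
  finsler_norm (alpha t) (alpha^`() t).

(* For a piecewise C^1 path, alpha^`() is the velocity except at finitely     *)
(* many points, which do not contribute to the integral.                      *)
Definition length_GOmega (alpha : R -> bop V) : \bar R :=
  (\int[lebesgue_measure]_(t in `[0%R, 1%R]) (speed alpha t)%:E)%E.

(* G(Omega) is an embedded submanifold of B(V), so a G(Omega)-valued path is  *)
(* piecewise C^1 in G(Omega) if and only if it is so in B(V).                 *)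
Definition path_GOmega (g h : bop V) (alpha : R -> bop V) : Prop :=
  [/\ forall t, t \in `[0, 1] -> GOmega (alpha t),
      piecewise_C1 0 1 alpha, alpha 0 = g & alpha 1 = h].

Definition dist_GOmega (g h : bop V) : \bar R :=
  ereal_inf [set length_GOmega alpha | alpha in path_GOmega g h].

End Distance.

(* Main.v *)
From HB Require Import structures.
Require Import Defs.
From mathcomp Require Import all_boot all_order all_algebra.
From mathcomp Require Import all_classical all_reals all_analysis.
From mathcomp Require Import measurable_realfun.
From mathcomp Require Import ring lra.
Set Implicit Arguments.
Unset Strict Implicit.
Unset Printing Implicit Defensive.
Import Order.TTheory GRing.Theory Num.Theory.
Import numFieldNormedType.Exports.
Local Open Scope ring_scope.
Local Open Scope classical_set_scope.

(** The curve Lambda is a left translate of a one-parameter group, so its velocity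
    is Lambda L_v. It therefore solves the spray equation and has constant speed
    |L_v|, which equals |v| since L_v maps the unit e to v. Two things remain:
    Lambda stays in G(Omega), and no path in G(Omega) with the same end points is
    shorter.

    The first rests on one inequality. Call x positive if |r e - x| <= r for some r.
    This is a closed convex cone, and the axioms of a JB-algebra make it the closure
    of the squares. Expanding the square of x + r h v shows that
    x + h (v o x) >= - C h^2 e for every positive x, every v and both signs of h
    (jpos_step). So solutions of z' = w o z stay in the open cone, as an Euler
    scheme proves (jbounded_below_flow). The curve exp (t L_v) x is such a solution.
    So is U_(p t) x along the segment p t from e to p, by the Jordan identity
    L_(1/x) U_x = L_x (LU_inv, U_flow). Running the flows in both directions shows
    that exp (L_v) and U_p map Omega onto itself (exp_L_GOmega, U_GOmega). The same
    inequality proves that a positive invertible element dominates a positive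
    multiple of e, which identifies the spectral cone Omega with the interior of
    the cone of positive elements (jconeP).

    For the second, let alpha be a path in G(Omega) of length l. For every fixed
    invertible operator c the function ln |c alpha| varies by at most l
    (curve_length). Choosing for c the inverses of the two end points yields
    |exp (L_v)| <= exp l and |exp (- L_v)| <= exp l, hence
    |exp (n L_v) e + exp (- n L_v) e| <= 2 exp (n l) for all n. The left-hand side is
    the norm of a sum of squares, the even terms of the exponential series, so
    n^m |v^m| / m! <= exp (n l) for every even m, and |v^m| = |v|^m. Summing these
    bounds against powers of a number th < 1 gives
    exp (n th |v|) <= C exp (n l) for all n, whence |v| <= l (norm_le_of_exp). *)

Local Notation "x ** y" := (jmul x y) (at level 40, left associativity) : ring_scope.

(** * Identities between linear combinations *)

Section LinearCombinations.
Context {R : pzRingType} {W : lmodType R}.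

Inductive lmexp :=
  | LVar of nat | LZero | LAdd of lmexp & lmexp | LOpp of lmexp
  | LScale of R & lmexp | LMuln of lmexp & nat.

Fixpoint lmeval (env : seq W) (a : lmexp) : W :=
  match a with
  | LVar n => nth 0 env n
  | LZero => 0
  | LAdd a b => lmeval env a + lmeval env b
  | LOpp a => - lmeval env a
  | LScale c a => c *: lmeval env a
  | LMuln a n => lmeval env a *+ n
  end.

Fixpoint lmcoef (a : lmexp) (i : nat) : R :=
  match a with
  | LVar n => if eqn n i then 1 else 0
  | LZero => 0
  | LAdd a b => lmcoef a i + lmcoef b i
  | LOpp a => - lmcoef a i
  | LScale c a => c * lmcoef a i
  | LMuln a n => lmcoef a i *+ n
  end.

Fixpoint lmall (n : nat) (P : nat -> Prop) : Prop :=
  if n is n'.+1 then P n' /\ lmall n' P else True.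

Lemma lmevalE env a :
  lmeval env a = \sum_(i < size env) lmcoef a i *: nth 0 env i.
Proof.
elim: a => /= [n||a -> b ->|a ->|c a ->|a -> n].
(* an index outside env denotes the default value 0, and no term of the sum matches it *)
- have [nlt|nge] := ltnP n (size env); last first.
    rewrite nth_default// big1// => i _; case: eqnP => [ni|]; rewrite ?scale0r//.
    by move: (ltn_ord i); rewrite -ni ltnNge nge.
  rewrite (bigD1 (Ordinal nlt))//= big1 => [|i].
    by case: eqnP => // _; rewrite scale1r addr0.
  by rewrite -val_eqE /= => /eqP ni; case: eqnP => [/esym//|_]; rewrite scale0r.
- by rewrite big1// => i _; rewrite scale0r.
- by rewrite -big_split; apply: eq_bigr => i _; rewrite scalerDl.
- by rewrite -sumrN; apply: eq_bigr => i _; rewrite scaleNr.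
- by rewrite scaler_sumr; apply: eq_bigr => i _; rewrite scalerA.
- by rewrite -sumrMnl; apply: eq_bigr => i _; rewrite scalerMnl.
Qed.

Lemma lmeval_eq env a b :
  lmall (size env) (fun i => lmcoef a i = lmcoef b i) ->
  lmeval env a = lmeval env b.
Proof.
rewrite !lmevalE => ab; apply: eq_bigr => -[i /= ilt] _; congr (_ *: _).
elim: (size env) ilt ab => // n ih; rewrite ltnS leq_eqVlt => /predU1P[->|lt] [hn h] //.
exact: ih.
Qed.

End LinearCombinations.

Ltac lm_mem x env :=
  match env with
  | nil => false
  | cons x _ => true
  | cons _ ?l => lm_mem x l
  end.
Ltac lm_atom env t :=
  let b := lm_mem t env in
  match b with true => env | false => constr:(cons t env) end.
Ltac lm_atoms env t :=
  match t with
  | @Algebra.zero _ => env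
  | @Algebra.add _ ?a ?b => let env := lm_atoms env a in lm_atoms env b
  | @Algebra.opp _ ?a => lm_atoms env a
  | @GRing.scale _ _ _ ?a => lm_atoms env a
  | @Algebra.natmul _ ?a _ => lm_atoms env a
  | _ => lm_atom env t
  end.
Ltac lm_index env t :=
  match env with
  | cons t _ => constr:(0%N)
  | cons _ ?l => let n := lm_index l t in constr:(S n)
  end.
Ltac lm_reify R env t :=
  match t with
  | @Algebra.zero _ => constr:(@LZero R)
  | @Algebra.add _ ?a ?b =>
      let a := lm_reify R env a in let b := lm_reify R env b in constr:(@LAdd R a b)
  | @Algebra.opp _ ?a => let a := lm_reify R env a in constr:(@LOpp R a)
  | @GRing.scale _ _ ?c ?a => let a := lm_reify R env a in constr:(@LScale R c a)
  | @Algebra.natmul _ ?a ?n => let a := lm_reify R env a in constr:(@LMuln R a n)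
  | _ => let n := lm_index env t in constr:(@LVar R n)
  end.
(** Reflection: both sides are read as trees over a common list of atoms, so that
    the identity follows from the equality of the coefficients of each atom, and
    these live in R, where ring and field decide. Products of operators and Jordan
    products are atoms. *)
Ltac lmod R :=
  lazymatch goal with |- @eq ?T ?x ?y =>
    let env := lm_atoms (@nil T) x in
    let env := lm_atoms env y in
    let a := lm_reify R env x in
    let b := lm_reify R env y in
    refine (@lmeval_eq R _ env a b _);
    cbv [size lmall lmcoef eqn]; repeat split; try ring; try (by field)
  end.

(** * The Banach algebra of bounded operators *)

Section OperatorNorm.
Context {R : realType} {V : normedModType R}.
Implicit Types S T : bop V.

Lemma bop_norm_ubound T x : `|T x| <= `|T| * `|x|.
Proof. exact: opnorm_ubound. Qed.

Lemma bop_norm_le T (M : R) :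
  0 <= M -> (forall x, `|T x| <= M * `|x|) -> `|T| <= M.
Proof.
move=> M0 hM; rewrite bop_normE; apply: opnorm_le => x x1.
by rewrite (le_trans (hM x))// -[leRHS]mulr1 ler_wpM2l.
Qed.

Lemma bop_normM S T : `|S * T| <= `|S| * `|T|.
Proof.
apply: bop_norm_le => [|x]; first by rewrite mulr_ge0.
rewrite (le_trans (bop_norm_ubound S (T x)))// -mulrA ler_wpM2l//.
exact: bop_norm_ubound.
Qed.

Lemma bop_norm1 : `|1 : bop V| <= 1.
Proof. by apply: bop_norm_le => // x; rewrite mul1r. Qed.

Lemma bop_normX T n : `|T ^+ n| <= `|T| ^+ n.
Proof.
elim: n => [|n ih]; first by rewrite !expr0 bop_norm1.
by rewrite !exprS (le_trans (bop_normM _ _))// ler_wpM2l.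
Qed.

Lemma bopMZl a S T : (a *: S) * T = a *: (S * T).
Proof. exact: bopP. Qed.

Lemma bopMZr a S T : S * (a *: T) = a *: (S * T).
Proof. by apply: bopP => x; apply: bop_funZ. Qed.

Lemma bopN T x : (- T) x = - T x.
Proof. by rewrite -scaleN1r bopZ scaleN1r. Qed.

Lemma bopB S T x : (S - T) x = S x - T x.
Proof. by rewrite bopD bopN. Qed.

Lemma bop_funN T x : T (- x) = - T x.
Proof. by rewrite -scaleN1r bop_funZ scaleN1r. Qed.

Lemma bop_funB T x y : T (x - y) = T x - T y.
Proof. by rewrite bop_funD bop_funN. Qed.

Lemma bop_sum (n : nat) (F : nat -> bop V) x :
  (\sum_(0 <= i < n) F i) x = \sum_(0 <= i < n) F i x.
Proof.
elim: n => [|n ih]; first by rewrite !big_geq.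
by rewrite !big_nat_recr//= -ih.
Qed.

Lemma bop_mul_cvgl {T : Type} {F : set_system T} {FF : Filter F}
    (A : bop V) (f : T -> bop V) (l : bop V) :
  f @ F --> l -> (fun t => A * f t) @ F --> A * l.
Proof.
move=> fl; apply/cvgrPdist_le => e e0.
have e0' : 0 < e / (`|A| + 1) by rewrite divr_gt0// ltr_wpDl.
move/cvgrPdist_le : fl => /(_ _ e0'); apply: filterS => t ht.
rewrite -mulrBr (le_trans (bop_normM _ _))//.
rewrite (@le_trans _ _ ((`|A| + 1) * `|l - f t|))//.
  by rewrite ler_wpM2r// lerDl.
by rewrite mulrC -ler_pdivlMr// ltr_wpDl.
Qed.

Lemma bop_mul_cvgr {T : Type} {F : set_system T} {FF : Filter F}
    (A : bop V) (f : T -> bop V) (l : bop V) :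
  f @ F --> l -> (fun t => f t * A) @ F --> l * A.
Proof.
move=> fl; apply/cvgrPdist_le => e e0.
have e0' : 0 < e / (`|A| + 1) by rewrite divr_gt0// ltr_wpDl.
move/cvgrPdist_le : fl => /(_ _ e0'); apply: filterS => t ht.
rewrite -mulrBl (le_trans (bop_normM _ _))//.
rewrite (@le_trans _ _ (`|l - f t| * (`|A| + 1)))//.
  by rewrite ler_wpM2l// lerDl.
by rewrite -ler_pdivlMr// ltr_wpDl.
Qed.

Lemma bop_mul_cvg {T : Type} {F : set_system T} {FF : Filter F}
    (f g : T -> bop V) (l m : bop V) :
  f @ F --> l -> g @ F --> m -> (fun t => f t * g t) @ F --> l * m.
Proof.
move=> fl gm; apply/cvgrPdist_le => e e0.
have l0 : 0 < e / 2 / (`|l| + 1) by rewrite !divr_gt0// ltr_wpDl.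
have m0 : 0 < e / 2 / (`|m| + 1) by rewrite !divr_gt0// ltr_wpDl.
have gb : \forall t \near F, `|g t| <= `|m| + 1.
  by apply: (cvgr_norm_le _ gm); rewrite ltrDl.
move/cvgrPdist_le : gm => /(_ _ l0); move/cvgrPdist_le : fl => /(_ _ m0).
apply: filterS3 gb => t gt ft ht.
rewrite (_ : l * m - f t * g t = l * (m - g t) + (l - f t) * g t); last first.
  by rewrite mulrBr mulrBl addrA subrK.
rewrite [leRHS]splitr (le_trans (ler_normD _ _))//; apply: lerD.
  rewrite (le_trans (bop_normM _ _))//.
  rewrite (@le_trans _ _ ((`|l| + 1) * `|m - g t|))//.
    by rewrite ler_wpM2r// lerDl.
  by rewrite mulrC -ler_pdivlMr// ltr_wpDl.
rewrite (le_trans (bop_normM _ _))//.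
rewrite (@le_trans _ _ (`|l - f t| * (`|m| + 1)))//.
  by rewrite ler_wpM2l.
by rewrite -ler_pdivlMr// ltr_wpDl.
Qed.

Lemma bop_eval_cvg {T : Type} {F : set_system T} {FF : Filter F}
    (f : T -> bop V) (l : bop V) (x : V) :
  f @ F --> l -> (fun t => f t x) @ F --> l x.
Proof.
move=> fl; apply/cvgrPdist_le => e e0.
have e0' : 0 < e / (`|x| + 1) by rewrite divr_gt0// ltr_wpDl.
move/cvgrPdist_le : fl => /(_ _ e0'); apply: filterS => t ht.
rewrite -bopB (le_trans (bop_norm_ubound _ _))//.
rewrite (@le_trans _ _ (`|l - f t| * (`|x| + 1)))//.
  by rewrite ler_wpM2l// lerDl.
by rewrite -ler_pdivlMr// ltr_wpDl.
Qed.

End OperatorNorm.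

Section Completeness.
Context {R : realType} {V : completeNormedModType R}.

(** The pointwise limit of a Cauchy filter of operators exists in V; it is again
    bounded because the filter eventually stays within distance 1 of one operator. *)
Lemma bop_complete (F : set_system (bop V)) :
  ProperFilter F -> cauchy F -> cvg F.
Proof.
move=> FF Fc.
have Fb (e : R) : 0 < e ->
    exists2 A, F A & forall S T, A S -> A T -> `|S - T| <= e.
  move=> e0; have [[A B] [/= FA FB] AB] := (cauchy_ballP _).2 Fc e e0.
  exists (A `&` B); first exact: filterI.
  move=> S T [AS _] [_ BT]; apply/ltW.
  by have := AB (S, T) (conj AS BT); rewrite /= -ball_normE.
have fx x : cvg ((fun T : bop V => T x) @ F).
  apply: cauchy_cvg; apply/cauchy_ballP => e e0; rewrite near_map2.
  have e0' : 0 < e / (`|x| + 1) by rewrite divr_gt0// ltr_wpDl.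
  have e2 : 0 < e / (`|x| + 1) / 2 by rewrite divr_gt0.
  have [A FA hA] := Fb _ e2.
  exists (A, A) => // -[S T] [/= AS AT]; rewrite -ball_normE /=.
  rewrite -bopB (le_lt_trans (bop_norm_ubound _ _))//.
  rewrite (@le_lt_trans _ _ (e / (`|x| + 1) / 2 * `|x|))//.
    by rewrite ler_wpM2r// hA.
  rewrite (@le_lt_trans _ _ (e / 2))//; last by rewrite ltr_pdivrMr// ltr_pMr// ltr1n.
  rewrite mulrAC ler_pM2r// mulrAC ler_pdivrMr ?ltr_wpDl//.
  by rewrite ler_pM2l// lerDl.
pose f (x : V) : V := lim ((fun T : bop V => T x) @ F).
(* the Cauchy estimate, uniform on the unit ball, survives the pointwise limit *)
have hf (e : R) : 0 < e ->
    exists2 A, F A & forall T, A T -> forall x, `|T x - f x| <= e * `|x|.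
  move=> e0; have [A FA hA] := Fb e e0; exists A => // T AT x.
  have : (fun S : bop V => `|T x - S x|) @ F --> `|T x - f x|.
    by apply: cvg_norm; apply: cvgB; [exact: cvg_cst|exact: fx].
  move/cvgr_to_le; apply; apply: filterS FA => S AS.
  by rewrite -bopB (le_trans (bop_norm_ubound _ _))// ler_wpM2r// hA.
have f_bounded : bounded_op f.
  split=> [a x y|].
    have : (fun T : bop V => a *: T x + T y) @ F --> a *: f x + f y.
      by apply: cvgD; [apply: cvgZr; exact: fx|exact: fx].
    under eq_fun do rewrite -bop_linear.
    by move/(cvg_lim (@norm_hausdorff _ _)).
  have [A FA hA] := hf 1 ltr01; have [T AT] := filter_ex FA.
  exists (1 + `|T|) => x; rewrite mulrDl -[X in `|X|](subrK (T x)).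
  rewrite (le_trans (ler_normD _ _))// lerD ?bop_norm_ubound//.
  by rewrite distrC hA.
apply/cvg_ex; exists (mk_bop f_bounded); apply/cvgrPdist_le => e e0.
have [A FA hA] := hf e e0; apply: filterS FA => T AT.
apply: bop_norm_le => [|x]; first exact: ltW.
by rewrite bopB distrC hA.
Qed.

HB.instance Definition _ := Uniform_isComplete.Build (bop V) bop_complete.
End Completeness.

(** * Neumann series and exponential *)

Lemma cvg_unique_lim {R : realType} {W : normedModType R} (u : nat -> W) (l m : W) :
  u @ \oo --> l -> u @ \oo --> m -> l = m.
Proof. by move=> ul um; apply: (cvg_unique _ ul um); exact: norm_hausdorff. Qed.

Lemma series_norm_cvg {R : realType} {W : completeNormedModType R}
    (u : nat -> W) (c : nat -> R) :
  (forall n, `|u n| <= c n) -> cvgn (series c) -> cvgn (series u).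
Proof.
move=> uc cc; apply: normed_cvg.
apply: (series_le_cvg _ _ _ cc) => n /=; first exact: normr_ge0.
  exact: le_trans (normr_ge0 _) (uc n).
exact: uc.
Qed.

Section Neumann.
Context {R : realType} {V : completeNormedModType R}.
Implicit Types S T B : bop V.

Lemma bop_invP T : bop_invertible T -> bop_is_inverse T (bop_inv T).
Proof. by move=> hT; exact: (@getPex _ (bop_is_inverse T)). Qed.

Lemma bop_inv_comm T S B : bop_is_inverse T S -> B * T = T * B -> B * S = S * B.
Proof.
move=> [TS ST] BT.
by rewrite -[B * S]mul1r -ST -mulrA [T * _]mulrA -BT -[B * T * S]mulrA TS mulr1.
Qed.

Lemma bop_invertibleM S T :
  bop_invertible S -> bop_invertible T -> bop_invertible (S * T).
Proof.
move=> [S' [SS' S'S]] [T' [TT' T'T]]; exists (T' * S'); split.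
  by rewrite -mulrA (mulrA T) TT' mul1r.
by rewrite -mulrA (mulrA S') S'S mul1r.
Qed.

(** The partial sums satisfy s (n + 1) = 1 + T s n = 1 + s n T, whose limit is the
    inverse property, and whose norm gives the bound. *)
Lemma neumann T : `|T| < 1 -> exists S,
  [/\ series (fun n => T ^+ n) @ \oo --> S, bop_is_inverse (1 - T) S &
      `|S| <= (1 - `|T|)^-1].
Proof.
move=> T1.
have cT : cvgn (series (fun n => T ^+ n)).
  apply: (@series_norm_cvg _ _ _ (geometric 1 `|T|)) => [n|].
    by rewrite /geometric /= mul1r bop_normX.
  by apply: is_cvg_geometric_series; rewrite ger0_norm.
set S := limn (series (fun n => T ^+ n)) in cT; exists S.
have SE1 : S = 1 + T * S.
  apply: (@cvg_unique_lim _ _ (fun n => series (fun n => T ^+ n) n.+1)).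
    by rewrite (cvg_shiftS (series _)).
  rewrite (_ : (fun n => _) = fun n => 1 + T * series (fun n => T ^+ n) n).
    by apply: cvgD; [exact: cvg_cst|exact: bop_mul_cvgl cT].
  apply/funext => n.
  rewrite /series /= big_nat_recl//= expr0; congr (_ + _).
  by rewrite mulr_sumr; apply: eq_bigr => i _; rewrite exprS.
have SE2 : S = 1 + S * T.
  apply: (@cvg_unique_lim _ _ (fun n => series (fun n => T ^+ n) n.+1)).
    by rewrite (cvg_shiftS (series _)).
  rewrite (_ : (fun n => _) = fun n => 1 + series (fun n => T ^+ n) n * T).
    by apply: cvgD; [exact: cvg_cst|exact: bop_mul_cvgr cT].
  apply/funext => n.
  rewrite /series /= big_nat_recl//= expr0; congr (_ + _).
  by rewrite mulr_suml; apply: eq_bigr => i _; rewrite exprSr.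
split=> //.
  split; first by rewrite mulrBl mul1r {1}SE1 addrK.
  by rewrite mulrBr mulr1 {1}SE2 addrK.
rewrite -div1r ler_pdivlMr ?subr_gt0// mulrBr mulr1 lerBlDr.
rewrite {1}SE2 (le_trans (ler_normD _ _))// lerD ?bop_norm1//.
exact: bop_normM.
Qed.

(** Makes the filter structure of neighborhoods visible to instance resolution on
    the carrier of operators. *)
#[local] Instance bop_nbhs_filter T : ProperFilter (nbhs T) := nbhs_pfilter T.

(** If T' inverts T then S = T (1 - T' (T - S)), to which the Neumann series applies
    as soon as T' (T - S) has norm less than 1. *)
Lemma bop_invertible_near T :
  bop_invertible T -> \forall S \near T, bop_invertible S.
Proof.
move=> [T' [TT' T'T]].
have e0 : 0 < (`|T'| + 1)^-1 by rewrite invr_gt0 ltr_wpDl.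
near=> S.
have ST : `|T - S| < (`|T'| + 1)^-1.
  by near: S; apply: cvgr_dist_lt => //; exact: cvg_id.
have small : `|T' * (T - S)| < 1.
  rewrite (le_lt_trans (bop_normM _ _))//.
  rewrite (@le_lt_trans _ _ (`|T'| * (`|T'| + 1)^-1))//.
    by rewrite ler_wpM2l// ltW.
  by rewrite ltr_pdivrMr ?ltr_wpDl// mul1r ltrDl.
have [N [_ NI _]] := neumann small.
have -> : S = T * (1 - T' * (T - S)).
  by rewrite mulrBr mulr1 mulrA TT' mul1r opprB addrC subrK.
by apply: bop_invertibleM; [exists T'|exists N].
Unshelve. all: by end_near. Qed.

(** Resolvent identity: T' - S' = - S' (T - S) T' for the inverses T', S' of T, S. The
    first smallness condition below keeps S' bounded by twice the bound on T'. *)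
Lemma bop_inv_continuous T :
  bop_invertible T -> bop_inv x @[x --> T] --> bop_inv T.
Proof.
move=> iT; have [TT' T'T] := bop_invP iT; set T' := bop_inv T in TT' T'T *.
apply/cvgrPdist_le => e e0.
have k0 : 0 < `|T'| + 1 by rewrite ltr_wpDl.
have e1 : 0 < (2 * (`|T'| + 1))^-1 by rewrite invr_gt0 mulr_gt0.
have e2 : 0 < e / (2 * (`|T'| + 1) ^+ 2).
  by rewrite divr_gt0// mulr_gt0// exprn_gt0.
near=> S.
have iS : bop_invertible S by near: S; exact: bop_invertible_near.
have d1 : `|T - S| <= (2 * (`|T'| + 1))^-1.
  by near: S; apply: cvgr_dist_le => //; exact: cvg_id.
have d2 : `|T - S| <= e / (2 * (`|T'| + 1) ^+ 2).
  by near: S; apply: cvgr_dist_le => //; exact: cvg_id.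
have [SS' S'S] := bop_invP iS; set S' := bop_inv S in SS' S'S *.
have dE : T' - S' = - (S' * (T - S) * T').
  by rewrite mulrBr S'S mulrBl mul1r -mulrA TT' mulr1 opprB.
have bd : `|S'| <= 2 * (`|T'| + 1).
  have : `|S'| <= `|T'| + `|S'| * (2 * (`|T'| + 1))^-1 * (`|T'| + 1).
    rewrite -{1}[S'](subrK T') addrC (le_trans (ler_normD _ _))// lerD2l.
    rewrite -normrN opprB dE normrN (le_trans (bop_normM _ _))//.
    rewrite ler_pM// ?lerDl// (le_trans (bop_normM _ _))//.
    by rewrite ler_wpM2l.
  rewrite invfM mulrA -mulrA mulVf ?gt_eqF// mulr1.
  move: `|S'| `|T'| => a b; lra.
rewrite dE normrN (le_trans (bop_normM _ _))//.
rewrite (@le_trans _ _ (2 * (`|T'| + 1) * (e / (2 * (`|T'| + 1) ^+ 2)) *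
                        (`|T'| + 1)))//.
  rewrite ler_pM// ?lerDl// (le_trans (bop_normM _ _))//.
  by rewrite ler_pM.
move: (`|T'| + 1) k0 => k k0.
rewrite (_ : 2 * k * _ * k = e)//.
by field; rewrite gt_eqF.
Unshelve. all: by end_near. Qed.

End Neumann.

Section ExponentialTruncation.
Context {R : realType} {W : lmodType R}.
Implicit Types (F : nat -> W) (s t : R).

Definition exp_trunc F s n : W := \sum_(0 <= k < n) (s ^+ k / k`!%:R) *: F k.

(** The product of two truncated exponentials contains the truncation of the
    exponential of the sum; what is left over are the terms with i + j >= n. The
    sequence F stands for the powers of an operator or of a real number. *)
Lemma exp_trunc_defect F s t n :
  \sum_(0 <= i < n) \sum_(0 <= j < n)
      (s ^+ j / j`!%:R * (t ^+ i / i`!%:R)) *: F (j + i)%N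
    - exp_trunc F (s + t) n =
  \sum_(0 <= i < n) \sum_(n - i <= j < n)
      (s ^+ j / j`!%:R * (t ^+ i / i`!%:R)) *: F (j + i)%N.
Proof.
pose f j i := (s ^+ j / j`!%:R * (t ^+ i / i`!%:R)) *: F (j + i)%N.
have fE k : ((s + t) ^+ k / k`!%:R) *: F k = \sum_(0 <= i < k.+1) f (k - i)%N i.
  rewrite exprDn mulr_suml scaler_suml big_mkord.
  apply: eq_bigr => i _; have ik : (i <= k)%N by rewrite -ltnS.
  rewrite /f subnK//; congr (_ *: _); rewrite -(bin_fact ik) !natrM -mulr_natr.
  have h1 : i`!%:R != 0 :> R by rewrite pnatr_eq0 -lt0n fact_gt0.
  have h2 : (k - i)`!%:R != 0 :> R by rewrite pnatr_eq0 -lt0n fact_gt0.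
  have h3 : 'C(k, i)%:R != 0 :> R by rewrite pnatr_eq0 -lt0n bin_gt0.
  by field; rewrite h1 h2 h3.
have -> : exp_trunc F (s + t) n =
    \sum_(0 <= i < n) \sum_(0 <= j < n - i) f j i.
  elim: n => [|n ih]; first by rewrite /exp_trunc !big_geq.
  rewrite /exp_trunc big_nat_recr//= -/(exp_trunc _ _ _) ih fE.
  rewrite !big_nat_recr//= subnn subSnn big_nat1 addrA -big_split/=.
  congr (_ + _); apply: eq_big_nat => i /andP[_ iN].
  by rewrite subSn 1?ltnW// big_nat_recr.
rewrite -sumrB; apply: eq_big_nat => i /andP[_ iN].
rewrite (@big_cat_nat _ _ _ (n - i) 0 n)//= ?leq_subr//.
by rewrite addrAC subrr add0r.
Qed.

End ExponentialTruncation.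

Section Exponential.
Context {R : realType} {V : completeNormedModType R}.
Implicit Types A T : bop V.

Lemma bop_exprZ (s : R) A n : (s *: A) ^+ n = s ^+ n *: A ^+ n.
Proof.
elim: n => [|n ih]; first by rewrite !expr0 scale1r.
by rewrite !exprS ih bopMZl bopMZr scalerA.
Qed.

Lemma bop_exp_series (s : R) A n :
  series (fun n => n`!%:R^-1 *: (s *: A) ^+ n) n = exp_trunc (fun k => A ^+ k) s n.
Proof.
rewrite /series /exp_trunc/=; apply: eq_bigr => k _.
by rewrite bop_exprZ scalerA mulrC.
Qed.

Lemma bop_exp_term_le A n : `|n`!%:R^-1 *: A ^+ n| <= exp_coeff `|A| n.
Proof.
rewrite normrZ ger0_norm ?invr_ge0// /exp_coeff /= mulrC.
by rewrite ler_wpM2r ?invr_ge0// bop_normX.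
Qed.

Lemma bop_exp_cvg A : series (fun n => n`!%:R^-1 *: A ^+ n) @ \oo --> bop_exp A.
Proof.
apply: (@series_norm_cvg _ _ _ (exp_coeff `|A|)); last exact: is_cvg_series_exp_coeff.
exact: bop_exp_term_le.
Qed.

Lemma bop_expZ_cvg (s : R) A :
  exp_trunc (fun k => A ^+ k) s @ \oo --> bop_exp (s *: A).
Proof.
rewrite (_ : exp_trunc _ _ = series (fun n => n`!%:R^-1 *: (s *: A) ^+ n)).
  exact: bop_exp_cvg.
by apply/funext => n; rewrite bop_exp_series.
Qed.

Lemma exp_trunc_real_cvg (a s : R) :
  exp_trunc (W := R^o) (fun k => a ^+ k) s @ \oo --> (expR (s * a) : R^o).
Proof.
rewrite (_ : exp_trunc _ _ = series (exp_coeff (s * a))).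
  exact: is_cvg_series_exp_coeff.
apply/funext => n; rewrite /exp_trunc /series /=; apply: eq_bigr => k _.
by rewrite /exp_coeff /= exprMn mulrAC.
Qed.

(** The defect between the product of truncations and the truncation of the sum has
    nonnegative coefficients in s, t and the powers of A, so its norm is at most the
    same defect for the numbers |s|, |t|, |A|, which tends to 0 by the addition formula
    of the real exponential. *)
Lemma bop_expD (s t : R) A :
  bop_exp ((s + t) *: A) = bop_exp (s *: A) * bop_exp (t *: A).
Proof.
pose X k := A ^+ k; pose a := `|A|.
pose Y k : R^o := a ^+ k.
have prodE n : exp_trunc X s n * exp_trunc X t n =
    \sum_(0 <= i < n) \sum_(0 <= j < n)
      (s ^+ j / j`!%:R * (t ^+ i / i`!%:R)) *: X (j + i)%N.
  rewrite /exp_trunc mulr_sumr; apply: eq_bigr => i _.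
  rewrite mulr_suml; apply: eq_bigr => j _.
  by rewrite bopMZl bopMZr scalerA -exprD.
have prodE' n : exp_trunc Y `|s| n * exp_trunc Y `|t| n =
    \sum_(0 <= i < n) \sum_(0 <= j < n)
      (`|s| ^+ j / j`!%:R * (`|t| ^+ i / i`!%:R)) *: Y (j + i)%N.
  rewrite /exp_trunc mulr_sumr; apply: eq_bigr => i _.
  rewrite mulr_suml; apply: eq_bigr => j _.
  by rewrite /Y exprD /GRing.scale /=; ring.
have le n : `|exp_trunc X s n * exp_trunc X t n - exp_trunc X (s + t) n| <=
    exp_trunc Y `|s| n * exp_trunc Y `|t| n - exp_trunc Y (`|s| + `|t|) n.
  rewrite prodE prodE' !exp_trunc_defect (le_trans (ler_norm_sum _ _ _))//.
  apply: ler_sum => i _; rewrite (le_trans (ler_norm_sum _ _ _))//.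
  apply: ler_sum => j _; rewrite normrZ !normrM !normfV !normrX !normr_nat.
  by rewrite ler_wpM2l ?bop_normX// mulr_ge0// divr_ge0.
have to0 : (fun n => exp_trunc Y `|s| n * exp_trunc Y `|t| n -
    exp_trunc Y (`|s| + `|t|) n) @ \oo --> (0 : R^o).
  rewrite -(subrr (expR ((`|s| + `|t|) * a))) {1}mulrDl expRD.
  by apply: cvgB; [apply: cvgM|]; exact: exp_trunc_real_cvg.
have dto0 : (fun n => exp_trunc X s n * exp_trunc X t n -
    exp_trunc X (s + t) n) @ \oo --> (0 : bop V).
  apply/norm_cvg0P; apply: squeeze_cvgr (cvg_cst 0) to0.
  by apply: nearW => n; rewrite le normr_ge0.
apply/esym/eqP; rewrite -subr_eq0; apply/eqP.
apply: cvg_unique_lim dto0; apply: cvgB; last exact: bop_expZ_cvg.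
by apply: bop_mul_cvg; exact: bop_expZ_cvg.
Qed.

(** After removal of the first two terms, (k + 2)! >= k! compares the tail with
    the series of the real exponential. *)
Lemma bop_exp_taylor A : `|bop_exp A - 1 - A| <= `|A| ^+ 2 * expR `|A|.
Proof.
have : (fun n => `|series (fun n => n`!%:R^-1 *: A ^+ n) n - 1 - A|) @ \oo -->
    `|bop_exp A - 1 - A|.
  apply: cvg_norm; apply: cvgB; last exact: cvg_cst.
  by apply: cvgB; [exact: bop_exp_cvg|exact: cvg_cst].
move/cvgr_to_le; apply; exists 2%N => // -[//|[//|n]] _ /=.
rewrite /series /= 2?big_nat_recl//= expr0 expr1 !fact0 invr1 !scale1r.
rewrite [1 + _]addrC addrK [A + _]addrC addrK.
rewrite (le_trans (ler_norm_sum _ _ _))//.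
rewrite (@le_trans _ _ (`|A| ^+ 2 * series (exp_coeff `|A|) n))//.
  rewrite mulr_sumr; apply: ler_sum => k _.
  rewrite (le_trans (bop_exp_term_le _ _))// /exp_coeff /=.
  rewrite (_ : `|A| ^+ k.+2 = `|A| ^+ 2 * `|A| ^+ k); last by rewrite -exprD.
  rewrite -mulrA.
  rewrite ler_wpM2l ?exprn_ge0// ler_wpM2l ?exprn_ge0//.
  by rewrite lef_pV2 ?posrE ?ltr0n ?fact_gt0// ler_nat !factS mulnA leq_pmull.
rewrite ler_wpM2l//; apply: nondecreasing_cvgn_le; last exact: is_cvg_series_exp_coeff.
by apply/nondecreasing_series => k _ _; exact: exp_coeff_ge0.
Qed.

Lemma bop_exp0 : bop_exp (0 : bop V) = 1.
Proof.
have := bop_exp_taylor 0; rewrite normr0 expr0n mul0r subr0 normr_le0 subr_eq0.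
by move/eqP.
Qed.

End Exponential.

(** * One-parameter groups of operators *)

Section ExponentialFlow.
Context {R : realType} {V : completeNormedModType R}.
Implicit Types A P : bop V.

Lemma is_derive_of_quadratic {W : normedModType R} (f : R -> W) (t C : R) (l : W) :
  (forall h, `|h| <= 1 -> `|f (t + h) - f t - h *: l| <= C * h ^+ 2) ->
  is_derive t 1 f l.
Proof.
move=> hf.
have lim : h^-1 *: ((f \o shift t) (h *: 1) - f t) @[h --> 0^'] --> l.
  apply/cvgrPdist_le => e e0.
  have e1 : 0 < e / (`|C| + 1) by rewrite divr_gt0// ltr_wpDl.
  near=> h.
  have h0 : h != 0 by near: h; exact: nbhs_dnbhs_neq.
  have hn0 : 0 < `|h| by rewrite normr_gt0.
  have h1 : `|h| <= 1 by near: h; apply: dnbhs0_le.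
  have he : `|h| <= e / (`|C| + 1) by near: h; apply: dnbhs0_le.
  rewrite /= [h *: 1]mulr1 [h + t]addrC distrC.
  rewrite -[X in _ - X](scalerK h0) -scalerBr normrZ normfV.
  rewrite ler_pdivrMl// (le_trans (hf _ h1))//.
  rewrite (@le_trans _ _ (`|h| * ((`|C| + 1) * `|h|)))//.
    rewrite (_ : `|h| * _ = (`|C| + 1) * h ^+ 2); last first.
      by rewrite -(real_normK (num_real h)); ring.
    rewrite ler_wpM2r ?sqr_ge0//.
    by rewrite (le_trans (ler_norm _))// lerDl.
  by rewrite ler_pM2l// mulrC -ler_pdivlMr// ltr_wpDl.
by apply: DeriveDef; [apply/cvg_ex; exists l|exact/cvg_lim/lim].
Unshelve. all: by end_near. Qed.

Lemma bop_expK A : bop_exp A * bop_exp (- A) = 1.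
Proof.
by rewrite -{1}[A]scale1r -scaleN1r -bop_expD subrr scale0r bop_exp0.
Qed.

Lemma bop_exp_is_inverse A : bop_is_inverse (bop_exp A) (bop_exp (- A)).
Proof. by split; [exact: bop_expK|rewrite -{2}[A]opprK bop_expK]. Qed.

Lemma bop_exp_natZ n A : bop_exp (n%:R *: A) = bop_exp A ^+ n.
Proof.
elim: n => [|n ih]; first by rewrite scale0r bop_exp0 expr0.
by rewrite -natr1 bop_expD ih scale1r exprSr.
Qed.

Lemma bop_exp_norm A : `|bop_exp A| <= expR `|A|.
Proof.
have : (fun n => `|series (fun n => n`!%:R^-1 *: A ^+ n) n|) @ \oo --> `|bop_exp A|.
  by apply: cvg_norm; exact: bop_exp_cvg.
move/cvgr_to_le; apply; apply: nearW => n /=.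
rewrite (@le_trans _ _ (series (exp_coeff `|A|) n))//.
  rewrite /series /= (le_trans (ler_norm_sum _ _ _))//.
  by apply: ler_sum => k _; exact: bop_exp_term_le.
apply: nondecreasing_cvgn_le; last exact: is_cvg_series_exp_coeff.
by apply/nondecreasing_series => k _ _; exact: exp_coeff_ge0.
Qed.

(** By the group law the increment is exp (t A) times the Taylor remainder of
    exp (h A) at the origin. *)
Lemma bop_exp_step A (t h : R) : `|h| <= 1 ->
  `|bop_exp ((t + h) *: A) - bop_exp (t *: A) - h *: (bop_exp (t *: A) * A)|
    <= expR (`|t| * `|A|) * (`|A| ^+ 2 * expR `|A|) * h ^+ 2.
Proof.
move=> h1; rewrite bop_expD.
rewrite (_ : _ - _ - _ =
  bop_exp (t *: A) * (bop_exp (h *: A) - 1 - h *: A)); last first.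
  by rewrite !mulrBr mulr1 bopMZr.
rewrite (le_trans (bop_normM _ _))// -mulrA ler_pM//.
  by rewrite (le_trans (bop_exp_norm _))// ler_expR normrZ.
rewrite (le_trans (bop_exp_taylor _))// normrZ exprMn real_normK ?num_real//.
rewrite [leRHS]mulrC -mulrA ler_wpM2l ?sqr_ge0// ler_wpM2l ?sqr_ge0//.
by rewrite ler_expR ler_piMl.
Qed.

End ExponentialFlow.

(** * The cone of positive elements *)

Section OrderUnit.
Context {R : realType} {V : jbAlgType R}.
Implicit Types (a x y z v : V) (r s : R).

Local Notation e := (@junit R V).

Lemma jmulDl x y z : (x + y) ** z = x ** z + y ** z.
Proof. by have := jmul_linear z 1 x y; rewrite !scale1r. Qed.
Lemma jmulDr x y z : x ** (y + z) = x ** y + x ** z.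
Proof. by rewrite !(jmulC x) jmulDl. Qed.
Lemma jmul0l x : 0 ** x = 0.
Proof. by apply/(@addrI _ (0 ** x)); rewrite -jmulDl !addr0. Qed.
Lemma jmul0r x : x ** 0 = 0. Proof. by rewrite jmulC jmul0l. Qed.
Lemma jmulZl r x y : (r *: x) ** y = r *: (x ** y).
Proof. by have := jmul_linear y r x 0; rewrite !addr0 jmul0l addr0. Qed.
Lemma jmulZr r x y : x ** (r *: y) = r *: (x ** y).
Proof. by rewrite jmulC jmulZl jmulC. Qed.
Lemma jmulNl x y : (- x) ** y = - (x ** y).
Proof. by rewrite -scaleN1r jmulZl scaleN1r. Qed.
Lemma jmulNr x y : x ** (- y) = - (x ** y).
Proof. by rewrite jmulC jmulNl jmulC. Qed.
Lemma jmulr1 x : x ** e = x. Proof. by rewrite jmulC jmul1. Qed.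

Lemma jmul_sqrB x y : (x - y) ** (x - y) = x ** x - (x ** y) *+ 2 + y ** y.
Proof.
by rewrite jmulDl !jmulDr !jmulNl !jmulNr opprK (jmulC y x) mulr2n opprD !addrA.
Qed.

Lemma junit_norm_le1 : `|e| <= 1.
Proof.
have := jmul_norm_sqr e; rewrite jmul1 => h.
have [->|e0] := eqVneq `|e| 0; first exact: ler01.
by move/eqP: h; rewrite expr2 -[X in X == _]mulr1 (inj_eq (mulfI e0)) => /eqP <-.
Qed.

(** The root is e - y, where y solves y = (z + y o y) / 2. This map is a contraction
    of the ball of radius |z| because x o x - y o y = (x + y) o (x - y) by
    commutativity. *)
Lemma jsqrtB z : `|z| < 1 -> exists y, y ** y = e - z.
Proof.
move=> z1.
pose U := [set y : V | `|y| <= `|z|].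
pose f (y : V) : V := 2^-1 *: (z + y ** y).
have fU : {homo f : y / U y >-> U y}.
  move=> y yz; rewrite /U /= /f normrZ ger0_norm ?invr_ge0//.
  rewrite ler_pdivrMl// (le_trans (ler_normD _ _))// (mulrDl 1 1) mul1r lerD2l.
  rewrite (le_trans (jmul_norm _ _))// -[leRHS]mulr1 ler_pM//.
  by rewrite (le_trans yz)// ltW.
have fsubE x y : f x - f y = 2^-1 *: ((x + y) ** (x - y)).
  rewrite -scalerBr jmulDl !jmulDr !jmulNr (jmulC y x); congr (_ *: _).
  by rewrite opprD addrACA subrr add0r addrA subrK.
have ctr : is_contraction (mkfun fU).
  exists (NngNum (normr_ge0 z)); split => //= -[x y] [/= xz yz].
  change (`|f x - f y| <= `|z| * `|x - y|).
  rewrite fsubE normrZ ger0_norm ?invr_ge0// ler_pdivrMl// mulrA.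
  rewrite (le_trans (jmul_norm _ _))// ler_wpM2r//.
  by rewrite (le_trans (ler_normD _ _))// (mulrDl 1 1) mul1r lerD.
have clU : closed U.
  rewrite (_ : U = (fun y : V => `|y|) @^-1` [set r | r <= `|z|])//.
  by apply: closed_comp => [? _|]; [exact: norm_continuous|exact: closed_le].
have [|y _ yE] := banach_fixed_point ctr clU; first by exists 0; rewrite /U/= normr0.
have yy : y ** y = y *+ 2 - z.
  rewrite {3}yE /= /f -scaler_nat scalerA divff// scale1r.
  by rewrite addrC addKr.
by exists (e - y); rewrite jmul_sqrB jmul1 jmul1 yy addrA subrK.
Qed.

(** The closed positive cone. Expressing positivity by the norm makes convexity and
    closedness immediate; that squares are positive is then a theorem (jpos_sq). *)
Definition jpos x := exists r, `|r *: e - x| <= r.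

Lemma ler_addgt0 (r s C : R) : (forall d, 0 < d -> r <= s + C * d) -> r <= s.
Proof.
move=> h; apply/ler_addgt0Pl => d d0.
have C0 : 0 < `|C| + 1 by rewrite ltr_wpDl.
rewrite (le_trans (h _ (divr_gt0 d0 C0)))// addrC lerD2r.
rewrite mulrA ler_pdivrMr// mulrC ler_pM2l//.
by rewrite (le_trans (ler_norm _))// lerDl.
Qed.

Lemma norm_unit r : 0 <= r -> `|r *: e| <= r.
Proof. by move=> r0; rewrite normrZ ger0_norm// ler_piMr// junit_norm_le1. Qed.

Lemma normD_unit x r : 0 <= r -> `|x + r *: e| <= `|x| + r.
Proof.
by move=> r0; rewrite (le_trans (ler_normD _ _))// lerD2l norm_unit.
Qed.

Lemma jpos0 : jpos 0.
Proof. by exists 0; rewrite scale0r subr0 normr0. Qed.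

Lemma jposD x y : jpos x -> jpos y -> jpos (x + y).
Proof.
move=> [r rx] [s sy]; exists (r + s).
by rewrite scalerDl opprD addrACA (le_trans (ler_normD _ _))// lerD.
Qed.

Lemma jposZ c x : 0 <= c -> jpos x -> jpos (c *: x).
Proof.
move=> c0 [r rx]; exists (c * r).
by rewrite -scalerA -scalerBr normrZ ger0_norm// ler_wpM2l.
Qed.

Lemma jpos_unitB x r : `|x| <= r -> jpos (r *: e - x).
Proof. by move=> xr; exists r; rewrite opprB addrC subrK. Qed.

Lemma jpos_unitD x r : `|x| <= r -> jpos (r *: e + x).
Proof. by move=> xr; rewrite -[x]opprK; apply: jpos_unitB; rewrite normrN. Qed.

Lemma jpos_unit r : 0 <= r -> jpos (r *: e).
Proof. by move=> r0; exists r; rewrite subrr normr0. Qed.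

(** Adding a positive multiple of the unit turns the defining inequality into a strict
    one, so that jsqrtB applies after rescaling. *)
Lemma jpos_sqrt x d : jpos x -> 0 < d -> exists y, y ** y = x + d *: e.
Proof.
move=> [r rx] d0; have r0 : 0 <= r by rewrite (le_trans _ rx).
have rd0 : 0 < r + d by rewrite ltr_wpDl.
have rdn : r + d != 0 by rewrite gt_eqF.
have [|y yE] := @jsqrtB ((r + d)^-1 *: (r *: e - x)).
  rewrite normrZ ger0_norm ?invr_ge0 ?ltW// ltr_pdivrMl// mulr1.
  by rewrite (le_lt_trans rx)// ltrDl.
exists (Num.sqrt (r + d) *: y); rewrite jmulZl jmulZr scalerA -expr2.
rewrite sqr_sqrtr ?ltW// yE scalerBr scalerA divff// scale1r.
by rewrite scalerDl opprB addrC addrA subrK.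
Qed.

(** After rescaling, e - y o y = s o s is a square, and the axiom comparing s o s with
    s o s + y o y = e bounds its norm by that of the unit. *)
Lemma jpos_sq_bound y r : `|y| ^+ 2 < r -> `|r *: e - y ** y| <= r.
Proof.
move=> yr; have r0 : 0 < r by rewrite (le_lt_trans _ yr)// sqr_ge0.
have [|s sE] := @jsqrtB (r^-1 *: (y ** y)).
  rewrite normrZ ger0_norm ?invr_ge0 ?ltW// ltr_pdivrMl// mulr1.
  by rewrite jmul_norm_sqr.
have : `|s ** s| <= 1.
  rewrite (le_trans (jmul_norm_sqrD s ((Num.sqrt r)^-1 *: y)))//.
  rewrite jmulZl jmulZr scalerA -expr2 exprVn (sqr_sqrtr (ltW r0)) sE subrK.
  exact: junit_norm_le1.
have -> : s ** s = r^-1 *: (r *: e - y ** y).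
  by rewrite sE scalerBr scalerA mulVf ?gt_eqF// scale1r.
by rewrite normrZ gtr0_norm ?invr_gt0// ler_pdivrMl// mulr1.
Qed.

Lemma jpos_sq y : jpos (y ** y).
Proof. by exists (`|y| ^+ 2 + 1); apply: jpos_sq_bound; rewrite ltrDl. Qed.

(** The definition of positivity gives one radius; the point is that every radius above
    the norm of x will do. It follows from jpos_sq_bound for the squares x + d e. *)
Lemma jpos_norm_le x r : jpos x -> `|x| <= r -> `|r *: e - x| <= r.
Proof.
move=> px xr; apply: (@ler_addgt0 _ _ 3) => d d0.
have [y yE] := jpos_sqrt px d0.
have : `|y| ^+ 2 < r + 2 * d.
  rewrite -jmul_norm_sqr yE (le_lt_trans (normD_unit _ (ltW d0)))//.
  by move: (`|x|) xr => a xr; lra.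
move/jpos_sq_bound; rewrite yE => h.
rewrite (_ : r *: e - x = (r + 2 * d) *: e - (x + d *: e) - d *: e).
  rewrite (le_trans (ler_normB _ _))// (_ : r + 3 * d = r + 2 * d + d); last by ring.
  by rewrite lerD// norm_unit// ltW.
by lmod R.
Qed.

Lemma jpos_closed x :
  (forall d, 0 < d -> exists2 y, jpos y & `|x - y| <= d) -> jpos x.
Proof.
move=> h; exists `|x|; apply: (@ler_addgt0 _ _ 3) => d d0.
have [y py xy] := h d d0.
have yx : `|y| <= `|x| + d.
  rewrite -[y](subrK x) (le_trans (ler_normD _ _))// addrC lerD2l.
  by rewrite distrC.
have := jpos_norm_le py yx => hy.
rewrite (_ : `|x| *: e - x = (`|x| + d) *: e - y - (x - y) - d *: e).
  rewrite (_ : `|x| + 3 * d = `|x| + d + d + d); last by ring.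
  rewrite (le_trans (ler_normB _ _))// lerD ?norm_unit ?(ltW d0)//.
  by rewrite (le_trans (ler_normB _ _))// lerD.
by lmod R.
Qed.

(** Up to a small multiple of the unit, x and y - x are squares, and the norm of a
    square does not exceed the norm of its sum with another square. *)
Lemma jpos_mono x y : jpos x -> jpos (y - x) -> `|x| <= `|y|.
Proof.
move=> px pyx; apply: (@ler_addgt0 _ _ 3) => d d0.
have [s sE] := jpos_sqrt px d0; have [t tE] := jpos_sqrt pyx d0.
have := jmul_norm_sqrD s t; rewrite sE tE.
rewrite (_ : _ + (y - x + _) = y + (d + d) *: e) => [h|]; last by lmod R.
rewrite (_ : x = x + d *: e - d *: e) 1?(le_trans (ler_normB _ _))//; last by lmod R.
rewrite (_ : `|y| + 3 * d = `|y| + (d + d) + d); last by ring.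
rewrite lerD//; last by rewrite norm_unit// ltW.
by rewrite (le_trans h)// normD_unit// addr_ge0 ?ltW.
Qed.

(** Here 2 r x - x o x = r^2 e - (r e - x) o (r e - x), and r e - x has norm at most r. *)
Lemma jpos_sqrB x r : jpos x -> `|x| <= r -> jpos ((2 * r) *: x - x ** x).
Proof.
move=> px xr; have := jpos_norm_le px xr => h.
have r0 : 0 <= r by rewrite (le_trans _ xr).
have : jpos ((r ^+ 2) *: e - (r *: e - x) ** (r *: e - x)).
  apply: jpos_unitB; rewrite (le_trans (jmul_norm _ _))// expr2 ler_pM//.
congr jpos; rewrite jmul_sqrB !jmulZl !jmulZr !jmul1 scalerA -expr2.
by lmod R.
Qed.

End OrderUnit.

Section Cone.
Context {R : realType} {V : jbAlgType R}.
Implicit Types (a x y z v w : V) (r s : R).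

Local Notation e := (@junit R V).

(** Quasi-monotonicity of L_v, for both signs of h: moving from a positive x along
    v o x leaves the cone by at most O(h^2). Expand the square of x + r h v and
    bound x o x by 2 r x. *)
Lemma jpos_step x v r h : jpos x -> `|x| <= r -> 0 < r ->
  jpos (x + h *: (v ** x) + (r / 2 * h ^+ 2 * `|v| ^+ 2) *: e).
Proof.
move=> px xr r0; have rn : r != 0 by rewrite gt_eqF.
have p1 := jpos_sqrB px xr.
have p2 := jpos_sq (x + (r * h) *: v).
have p3 : jpos ((r * h) ^+ 2 *: (`|v| ^+ 2 *: e - v ** v)).
  by apply: jposZ; rewrite ?sqr_ge0//; apply: jpos_unitB; rewrite jmul_norm_sqr.
have r2 : 0 <= (2 * r)^-1 by rewrite invr_ge0 mulr_ge0// ltW.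
have := jposZ r2 (jposD (jposD p1 p2) p3); congr jpos.
rewrite jmulDl !jmulDr !jmulZl !jmulZr (jmulC x v).
by lmod R.
Qed.

(** Apply jpos_step along - y: a dominates h e - O(h^2) e, which is a positive multiple
    of e for h small. An invertible positive element is thus bounded away from 0. *)
Lemma jpos_bounded_below a y :
  jpos a -> a ** y = e -> exists2 d, 0 < d & jpos (a - d *: e).
Proof.
move=> pa ay; pose r := `|a| + 1; pose k := r * `|y| ^+ 2 + 1.
have r0 : 0 < r by rewrite ltr_wpDl.
have k0 : 0 < k by rewrite ltr_wpDl// mulr_ge0 ?sqr_ge0 ?(ltW r0).
have ar : `|a| <= r by rewrite lerDl.
have := jpos_step y (- k^-1) pa ar r0; rewrite jmulC ay => h.
(* k is large enough for the linear term in h = 1/k to dominate *)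
exists (k^-1 - r / 2 * (- k^-1) ^+ 2 * `|y| ^+ 2).
  rewrite sqrrN (_ : _ - _ = k^-1 ^+ 2 * (k - r / 2 * `|y| ^+ 2)).
    by rewrite mulr_gt0 ?exprn_gt0 ?invr_gt0// /k; nra.
  by field; rewrite gt_eqF.
move: h; congr jpos; lmod R.
Qed.

(** * Multiplication operators and Jordan inverses *)

Lemma L_E x y : L_ x y = x ** y. Proof. by []. Qed.

Lemma L_D x y : L_ (x + y) = L_ x + L_ y.
Proof. by apply: bopP => z; rewrite bopD !L_E jmulDl. Qed.

Lemma L_Z r x : L_ (r *: x) = r *: L_ x.
Proof. by apply: bopP => z; rewrite bopZ !L_E jmulZl. Qed.

Lemma L_N x : L_ (- x) = - L_ x.
Proof. by rewrite -scaleN1r L_Z scaleN1r. Qed.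

Lemma L_B x y : L_ (x - y) = L_ x - L_ y.
Proof. by rewrite L_D L_N. Qed.

Lemma L_unit : L_ e = 1 :> bop V.
Proof. by apply: bopP => z; rewrite L_E jmul1. Qed.

Lemma L_norm_le x : `|L_ x| <= `|x|.
Proof. by apply: bop_norm_le => // y; exact: jmul_norm. Qed.

Lemma junit_norm : (0 < `|e|) -> `|e| = 1.
Proof.
move=> e0; have := jmul_norm_sqr e; rewrite jmul1 => /eqP.
by rewrite expr2 -[X in X == _]mulr1 (inj_eq (mulfI (lt0r_neq0 e0))) => /eqP <-.
Qed.

Lemma L_norm x : `|L_ x| = `|x|.
Proof.
apply/le_anti; rewrite L_norm_le /= -[X in `|X| <= _]jmulr1.
rewrite (le_trans (bop_norm_ubound (L_ x) e))// ler_piMr//.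
exact: junit_norm_le1.
Qed.

(** The component of degree (2, 1) in (x, z) of the Jordan identity at x + z, extracted
    from the values at x + z and x - z. *)
Lemma jordan_polarised x z y :
  ((x ** z) ** (x ** y)) *+ 2 + (x ** x) ** (z ** y) =
  z ** ((x ** x) ** y) + (x ** ((x ** z) ** y)) *+ 2.
Proof.
pose D a b c := (a ** b) ** (c ** y) - c ** ((a ** b) ** y).
have DDl a b c d : D (a + b) c d = D a c d + D b c d.
  by rewrite /D !(jmulDl, jmulDr) opprD addrACA.
have DDr a b c d : D c d (a + b) = D c d a + D c d b.
  by rewrite /D !(jmulDl, jmulDr) opprD addrACA.
have DDm a b c d : D c (a + b) d = D c a d + D c b d.
  by rewrite /D !(jmulDl, jmulDr) opprD addrACA.
have DC a b c : D a b c = D b a c by rewrite /D (jmulC a b).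
have D0 a : D a a a = 0 by rewrite /D jmul_jordan subrr.
have DNl a b c : D (- a) b c = - D a b c by rewrite /D !(jmulNl, jmulNr) opprD.
have DNm a b c : D a (- b) c = - D a b c by rewrite /D !(jmulNl, jmulNr) opprD.
have DNr a b c : D a b (- c) = - D a b c by rewrite /D !(jmulNl, jmulNr) opprD.
have h a b : (D a b b *+ 2 + D b b a) + (D a a b + D a b a *+ 2) = 0.
  have := D0 (a + b); rewrite !(DDl, DDm, DDr) !D0 !(DC b a) => <-.
  by lmod R.
have h1 : D x z x *+ 2 + D x x z = 0.
  have := h x (- z); rewrite !(DNl, DNm, DNr, opprK) => h1.
  transitivity (2^-1 *: (0 - 0) : V); last by rewrite subrr scaler0.
  by rewrite -{1}(h x z) -{1}h1; lmod R.
by apply/eqP; rewrite -subr_eq0 -h1 /D; apply/eqP; lmod R.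
Qed.

(** The polarised Jordan identity, read as an identity of operators in the variable z. *)
Lemma L_sqrM x w : L_ ((x ** x) ** w) =
  L_ (x ** x) * L_ w + 2 *: (L_ (x ** w) * L_ x) - 2 *: (L_ x * L_ w * L_ x).
Proof.
apply: bopP => z; rewrite bopB bopD !bopZ /=.
have := jordan_polarised x z w; rewrite (jmulC z) (jmulC (x ** z) w) => h.
rewrite (jmulC (x ** w)).
transitivity ((x ** x) ** w ** z + (x ** (w ** (x ** z))) *+ 2
  - 2 *: (x ** (w ** (x ** z)))); first by lmod R.
by rewrite (jmulC _ z) -h; lmod R.
Qed.

(** The polarised Jordan identity, read as an identity of operators in the variable y. *)
Lemma L_sqr_comm x z :
  2 *: (L_ (x ** z) * L_ x) + L_ (x ** x) * L_ z =
  L_ z * L_ (x ** x) + 2 *: (L_ x * L_ (x ** z)).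
Proof.
by apply: bopP => y; rewrite !bopD !bopZ /= !scaler_nat; exact: jordan_polarised.
Qed.

Lemma L_jordan x : GRing.comm (L_ x) (L_ (x ** x)).
Proof. by apply: bopP => y /=; rewrite jmul_jordan. Qed.

Definition jpow x n : V := (L_ x ^+ n) e.

Lemma jpow0 x : jpow x 0 = e. Proof. by []. Qed.
Lemma jpow1 x : jpow x 1 = x. Proof. exact: jmulr1. Qed.
Lemma jpowS x n : jpow x n.+1 = x ** jpow x n.
Proof. by rewrite /jpow exprS. Qed.

Lemma jpowSS x n : jpow x n.+2 = (x ** x) ** jpow x n.
Proof.
transitivity ((L_ x ^+ n) (x ** x)).
  by rewrite /jpow -addn2 exprD expr2 /= jmulr1.
transitivity ((L_ x ^+ n * L_ (x ** x)) e); first by rewrite /= jmulr1.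
by rewrite -(commrX n (commr_sym (L_jordan x))).
Qed.

Lemma comm_scale (S T : bop V) r : GRing.comm S T -> GRing.comm S (r *: T).
Proof. by rewrite /GRing.comm bopMZl bopMZr => ->. Qed.

(** By jpowSS and L_sqrM, the multiplications by powers of x lie in the algebra
    generated by L_x and L_(x o x), which commute. *)
Lemma L_jpow_comm x n :
  GRing.comm (L_ x) (L_ (jpow x n)) /\ GRing.comm (L_ (x ** x)) (L_ (jpow x n)).
Proof.
(* the recursion has two steps *)
suff: (GRing.comm (L_ x) (L_ (jpow x n)) /\
       GRing.comm (L_ (x ** x)) (L_ (jpow x n))) /\
      (GRing.comm (L_ x) (L_ (jpow x n.+1)) /\
       GRing.comm (L_ (x ** x)) (L_ (jpow x n.+1))) by case.
elim: n => [|n [[h1 h2] [h3 h4]]].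
  rewrite jpow0 jpow1 L_unit; split; split; try exact: commr1.
  - exact: commr_refl.
  - exact/commr_sym/L_jordan.
split=> //; rewrite jpowSS L_sqrM -jpowS.
have hj := L_jordan x.
split; apply: commrB; try apply: commrD; do ?[apply: comm_scale | apply: commrM] => //;
  exact: commr_sym.
Qed.

(** Power associativity: L_(x^m) commutes with L_x, hence with its n-th iterate. *)
Lemma jpowD x m n : jpow x m ** jpow x n = jpow x (n + m).
Proof.
transitivity ((L_ (jpow x m) * L_ x ^+ n) e); first by [].
rewrite commrX; last by apply/commr_sym; have [] := L_jpow_comm x m.
by rewrite /= jmulr1 /jpow exprD.
Qed.

Definition jbounded_below x := exists2 d, 0 < d & jpos (x - d *: e).

(** Such an x is N (e - z) with z of norm less than 1, so L_x is inverted by a Neumann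
    series S. The Jordan inverse S e is a limit of polynomials in z, whence its
    multiplication operator commutes with L_x. *)
Lemma L_inverse x d : 0 < d -> jpos (x - d *: e) -> exists S : bop V,
  [/\ bop_is_inverse (L_ x) S, `|S| <= d^-1 & GRing.comm (L_ x) (L_ (S e))].
Proof.
move=> d0 px; pose r := `|x - d *: e|; pose N := r + d.
have N0 : 0 < N by rewrite ltr_wpDl ?normr_ge0.
have Nn : N != 0 by rewrite gt_eqF.
have := jpos_norm_le px (lexx _); rewrite -/r => hr.
pose z := N^-1 *: (r *: e - (x - d *: e)).
have xE : x = N *: (e - z).
  by rewrite /z scalerBr scalerA divff// scale1r /N; lmod R.
have zr : `|z| <= N^-1 * r.
  by rewrite normrZ gtr0_norm ?invr_gt0// ler_wpM2l// invr_ge0 ltW.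
have rN : N^-1 * r < 1 by rewrite ltr_pdivrMl// mulr1 ltrDl.
have Lz1 : `|L_ z| < 1 by rewrite L_norm (le_lt_trans zr).
have [S0 [cS0 [S0r S0l] nS0]] := neumann Lz1.
exists (N^-1 *: S0).
have LxE : L_ x = N *: (1 - L_ z) by rewrite xE L_Z L_B L_unit.
have comm0 : GRing.comm (L_ z) (L_ (S0 e)).
  pose u n := \sum_(0 <= k < n) jpow z k.
  have uE n : u n = series (fun n => L_ z ^+ n) n e.
    by rewrite /series /= bop_sum.
  have ucvg : (fun n => L_ (u n)) @ \oo --> L_ (S0 e).
    have : u @ \oo --> S0 e.
      rewrite (_ : u = fun n => series (fun n => L_ z ^+ n) n e).
        exact: bop_eval_cvg.
      exact/funext.
    move=> /cvgrPdist_le h; apply/cvgrPdist_le => d' d'0.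
    by apply: filterS (h _ d'0) => n; rewrite -L_B L_norm.
  apply: (@cvg_unique_lim _ _ (fun n => L_ z * L_ (u n))); first exact: bop_mul_cvgl.
  rewrite (_ : (fun n => _) = fun n => L_ (u n) * L_ z).
    exact: bop_mul_cvgr.
  apply/funext => n; rewrite /u; elim: n => [|n ih].
    by rewrite big_geq// (_ : L_ 0 = 0) ?mulr0 ?mul0r// -[0](scale0r e) L_Z !scale0r.
  rewrite big_nat_recr//= L_D mulrDr mulrDl ih; congr (_ + _).
  by have [] := L_jpow_comm z n.
split.
- split; rewrite LxE bopMZl bopMZr scalerA ?divff ?mulVf// scale1r//.
- rewrite normrZ gtr0_norm ?invr_gt0// ler_pdivrMl//.
  rewrite (le_trans nS0)// -[leRHS]invrK lef_pV2 ?posrE ?subr_gt0//; last first.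
    by rewrite invr_gt0 mulr_gt0 ?invr_gt0.
  rewrite invfM invrK L_norm lerBrDr (le_trans (lerD (lexx _) zr))//.
  by rewrite -mulrDr addrC -/N mulVf.
- rewrite bopZ LxE (L_Z _ (S0 e)); apply: comm_scale; apply/commr_sym/comm_scale.
  by apply: commrB; [exact: commr1|exact: commr_sym].
Qed.

Section Inverse.
Variables (x : V) (S : bop V).
Hypotheses (xS : bop_is_inverse (L_ x) S) (cS : GRing.comm (L_ x) (L_ (S e))).

Lemma jmul_inv : x ** S e = e.
Proof. by rewrite -[LHS]/((L_ x * S) e) xS.1. Qed.

Lemma jmul_sqr_inv : (x ** x) ** S e = x.
Proof.
rewrite -[LHS]/((L_ (x ** x) * S) e).
rewrite (bop_inv_comm xS); last by apply/esym; exact: L_jordan.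
rewrite -[LHS]/(S ((x ** x) ** e)) jmulr1.
by rewrite -[LHS]/((S * L_ x) x) xS.2.
Qed.

(** The relation between the quadratic representation and the inverse y of x. It
    follows from L_sqrM with w = y, since x o y = e and (x o x) o y = x. *)
Lemma UL_inv : U_ x * L_ (S e) = L_ x.
Proof.
have := L_sqrM x (S e); rewrite jmul_sqr_inv jmul_inv L_unit mul1r -mulrA -cS => h.
have E : 2 *: (L_ x * (L_ x * L_ (S e))) - L_ (x ** x) * L_ (S e) =
    2 *: L_ x - (L_ (x ** x) * L_ (S e) + 2 *: L_ x -
                 2 *: (L_ x * (L_ x * L_ (S e)))) by lmod R.
rewrite /U_ mulrBl bopMZl expr2 -mulrA [LHS]E -h.
by lmod R.
Qed.

Lemma LU_inv : L_ (S e) * U_ x = L_ x.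
Proof.
rewrite -UL_inv /U_ mulrBr mulrBl bopMZl bopMZr expr2 -!mulrA cS.
rewrite [L_ (S e) * (L_ x * L_ x)]mulrA -cS -mulrA -cS.
have := L_sqr_comm x (S e); rewrite jmul_inv L_unit mul1r mulr1 addrC => /addIr ->.
by [].
Qed.

(** Since L_x is invertible, UL_inv and LU_inv provide inverses on both sides. *)
Lemma U_invertible : bop_invertible (U_ x).
Proof.
have [LS SL] := xS; exists (L_ (S e) * S).
split; first by rewrite mulrA UL_inv.
have h : S * L_ (S e) * U_ x = 1 by rewrite -mulrA LU_inv.
have h' : U_ x * (L_ (S e) * S) = 1 by rewrite mulrA UL_inv.
by rewrite -[L_ (S e) * S]mul1r -{1}h -[_ * U_ x * _]mulrA h' mulr1.
Qed.

End Inverse.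

Lemma jbounded_below_inv x : jbounded_below x -> jinvertible x.
Proof.
move=> [d d0 px]; have [S [xS _ _]] := L_inverse d0 px.
by exists (S e); rewrite jmul_inv ?jmul_sqr_inv.
Qed.

Lemma jbounded_belowD x y : jbounded_below x -> jpos y -> jbounded_below (x + y).
Proof.
by move=> [d d0 px] py; exists d => //; rewrite addrAC; exact: jposD.
Qed.

Lemma junit_eq0 : e = 0 -> forall x, x = 0.
Proof. by move=> e0 x; rewrite -[x]jmul1 e0 jmul0l. Qed.

Lemma jpos_unit_ge0 r : e != 0 -> jpos (r *: e) -> 0 <= r.
Proof.
move=> e0 pr; rewrite leNgt; apply/negP => r0.
have pos : jpos ((- r) *: e) by apply: jpos_unit; rewrite oppr_ge0 ltW.
have : jpos (0 - (- r) *: e) by rewrite sub0r scaleNr opprK.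
move/(jpos_mono pos); rewrite normr0 normr_le0 scaler_eq0 (negbTE e0) orbF.
by rewrite oppr_eq0 lt_eqF.
Qed.

(** The spectral cone consists of the elements bounded below by a positive multiple
    of the unit. If the supremum m of the lower bounds of x were at most 0, then
    x - m e would be positive and invertible, so bounded below by jpos_bounded_below,
    against the choice of m. *)
Lemma jconeP x : jcone x <-> jbounded_below x.
Proof.
split=> [hx|bx]; last first.
  move=> l hl /=; rewrite ltNge; apply/negP => l0; apply: hl.
  apply: jbounded_below_inv; rewrite -scaleNr; apply: jbounded_belowD => //.
  by apply: jpos_unit; rewrite oppr_ge0.
(* in the zero algebra every lower bound is allowed *)
have [e0|e0] := eqVneq e 0.
  by exists 1 => //; rewrite [X in jpos X](junit_eq0 e0); exact: jpos0.
pose A := [set r : R | jpos (x - r *: e)].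
have A0 : A (- `|x|) by rewrite /A/= scaleNr opprK addrC; apply: jpos_unitD.
have Aub : ubound A `|x|.
  move=> r /= pr; rewrite -subr_ge0; apply: jpos_unit_ge0 => //.
  have := jposD pr (jpos_unitB (lexx `|x|)); congr jpos; lmod R.
have hA : has_sup A by split; [exists (- `|x|)|exists `|x|].
pose m := sup A.
have Am : A m.
  apply: jpos_closed => d d0.
  have [r Ar rd] := sup_adherent d0 hA.
  exists (x - r *: e) => //.
  rewrite (_ : _ - _ = (r - m) *: e); last by lmod R.
  rewrite normrZ (le_trans (ler_piMr _ junit_norm_le1))//.
  have rm : r <= m by apply: ub_le_sup => //; case: hA.
  by rewrite ler0_norm ?subr_le0// opprB; move: rd; rewrite -/m; lra.
have [m0|m0] := ltP 0 m; first by exists m.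
have [y [/(jpos_bounded_below Am) [d d0 pd] _]] : jinvertible (x - m *: e).
  by apply: contrapT => /hx /=; rewrite ltNge m0.
have /(ub_le_sup hA.2) : A (m + d).
  by move: pd; rewrite /A /=; congr jpos; lmod R.
by rewrite -/m gerDl leNgt d0.
Qed.

End Cone.

(** * Invariance of the cone under multiplication flows *)

Section Invariance.
Context {R : realType} {V : jbAlgType R}.
Implicit Types (x y v w : V).

Local Notation e := (@junit R V).

(** An Euler scheme for z' = w o z: by jpos_step each step multiplies the lower bound
    by 1 - k h, where k bounds w, and costs O(h^2) more. *)
Lemma euler_invariance (z : nat -> V) (k m h C : R) (n : nat) :
  0 <= k -> 0 < m -> 0 <= h -> k * h < 1 -> (k + m) / 2 * k ^+ 2 + k <= C ->
  (forall i, (i < n)%N -> exists2 w, `|w| <= k &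
     `|z i.+1 - z i - h *: (w ** z i)| <= k * h ^+ 2) ->
  (forall i, (i < n)%N -> `|z i| <= k) ->
  jpos (z 0%N - m *: e) ->
  0 <= m * (1 - k * h) ^+ n - n%:R * (C * h ^+ 2) ->
  jpos (z n - (m * (1 - k * h) ^+ n - n%:R * (C * h ^+ 2)) *: e).
Proof.
move=> k0 m0 h0 kh hC; set a := 1 - k * h => hz bz pz.
have aE : a = 1 - k * h by [].
have a0 : 0 < a by rewrite subr_gt0.
have a1 : a <= 1 by rewrite gerBl mulr_ge0.
have D0 : 0 <= C * h ^+ 2.
  rewrite mulr_ge0 ?sqr_ge0// (le_trans _ hC)// addr_ge0//.
  by rewrite mulr_ge0 ?sqr_ge0// divr_ge0// addr_ge0// ltW.
clearbody a; elim: n hz bz => [|n ih] hz bz mn.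
  by rewrite expr0 mulr1 mul0r subr0.
pose mm := m * a ^+ n - n%:R * (C * h ^+ 2).
have mmS : m * a ^+ n.+1 - n.+1%:R * (C * h ^+ 2) <= mm * a - C * h ^+ 2.
  have : n%:R * (C * h ^+ 2) * a <= n%:R * (C * h ^+ 2).
    by rewrite ler_piMr// mulr_ge0.
  rewrite /mm (exprSr a n) -natr1 => nDa; rewrite -subr_ge0.
  rewrite (_ : _ - _ = n%:R * (C * h ^+ 2) - n%:R * (C * h ^+ 2) * a); last by ring.
  by rewrite subr_ge0.
have mm0 : 0 <= mm.
  have : 0 <= mm * a by move: mn mmS D0; lra.
  by rewrite pmulr_lge0.
have mmm : mm <= m.
  rewrite /mm lerBlDr (@le_trans _ _ m)//; last by rewrite lerDl mulr_ge0.
  by rewrite ler_piMr ?(ltW m0)// exprn_ile1 ?(ltW a0).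
have {ih} := ih (fun i iN => hz i (ltnW iN)) (fun i iN => bz i (ltnW iN)) mm0.
rewrite -/mm => px.
have [w wk zw] := hz n (ltnSn n); have bzn := bz n (ltnSn n).
have km0 : 0 < k + m by rewrite ltr_wpDl.
have xr : `|z n - mm *: e| <= k + m.
  rewrite (le_trans (ler_normB _ _))// lerD//.
  by rewrite (le_trans (norm_unit mm0)).
(* jpos_step applies to z n minus its lower bound; the unit part moves by h mm w,
   which is at least - h mm k e *)
have p1 := jpos_step w h px xr km0.
have p2 := jposZ (mulr_ge0 h0 mm0) (jpos_unitD wk).
have p3 := jpos_unitD zw.
have p4 : 0 <= mm - (m * a ^+ n.+1 - n.+1%:R * (C * h ^+ 2)) - h * mm * k
    - (k + m) / 2 * h ^+ 2 * `|w| ^+ 2 - k * h ^+ 2.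
  have : (k + m) / 2 * h ^+ 2 * `|w| ^+ 2 <= (k + m) / 2 * h ^+ 2 * k ^+ 2.
    apply: ler_wpM2l; last by rewrite lerXn2r ?nnegrE.
    by rewrite mulr_ge0 ?sqr_ge0// divr_ge0// (ltW km0).
  have : ((k + m) / 2 * k ^+ 2 + k) * h ^+ 2 <= C * h ^+ 2.
    by rewrite ler_wpM2r ?sqr_ge0.
  move: mmS; move: (m * a ^+ n.+1 - _) => M; clearbody mm; rewrite aE; lra.
have := jposD (jposD (jposD p1 p2) p3) (jpos_unit p4); congr jpos.
rewrite jmulDr jmulNr jmulZr jmulr1; lmod R.
Qed.

(** With h = 1/n the lower bound after n steps is m (1 - k/n)^n - O(1/n). The first term
    stays above m exp (- 2 k), so the bound is positive for n large. *)
Lemma jbounded_below_flow (z : R -> V) (k : R) :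
  (forall s h, 0 <= s -> 0 <= h -> s + h <= 1 -> exists2 w, `|w| <= k &
     `|z (s + h) - z s - h *: (w ** z s)| <= k * h ^+ 2) ->
  (forall s, 0 <= s <= 1 -> `|z s| <= k) ->
  jbounded_below (z 0) -> jbounded_below (z 1).
Proof.
move=> hz bz [m m0 pm].
have k0 : 0 <= k by rewrite (le_trans _ (bz 0 _))// lexx ler01.
pose C := (k + m) / 2 * k ^+ 2 + k.
have C0 : 0 <= C.
  by rewrite addr_ge0// mulr_ge0 ?sqr_ge0// divr_ge0// addr_ge0// ltW.
pose E := m * expR (- (2 * k)).
have E0 : 0 < E by rewrite mulr_gt0// expR_gt0.
have CE0 : 0 <= C / E by rewrite divr_ge0// (ltW E0).
pose N := Num.bound (2 * k + C / E + 1); pose n := N.+1.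
have nN : 2 * k + C / E + 1 < n%:R.
  apply: lt_le_trans (archi_boundP _) _; last by rewrite ler_nat.
  by rewrite addr_ge0// addr_ge0// mulr_ge0.
have n0 : 0 < n%:R :> R by rewrite ltr0n.
pose h := n%:R^-1 : R.
have h0 : 0 < h by rewrite invr_gt0.
have kh : k * h <= 2^-1.
  by rewrite /h ler_pdivrMr//; move: nN CE0; lra.
have nh : n%:R * h = 1 by rewrite divff// gt_eqF.
have aE : expR (- (2 * k)) <= (1 - k * h) ^+ n.
  have -> : - (2 * k) = n%:R * - (2 * (k * h)).
    by rewrite mulrN mulrCA [n%:R * (k * h)]mulrCA nh mulr1.
  have kh0 : 0 <= k * h by rewrite mulr_ge0// ltW.
  have t0 : 0 < 1 - k * h by move: kh; lra.
  rewrite expRM_natl lerXn2r ?nnegrE ?expR_ge0 ?(ltW t0)//.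
  rewrite expRN -[leRHS]invrK lef_pV2 ?posrE ?expR_gt0 ?invr_gt0//.
  rewrite -div1r ler_pdivrMr//.
  apply: (@le_trans _ _ ((1 + 2 * (k * h)) * (1 - k * h))).
    by move: (k * h) kh kh0 => t; nra.
  by rewrite ler_wpM2r ?(ltW t0)// expR_ge1Dx.
have CE : C * h < E.
  rewrite /h ltr_pdivrMr// mulrC -ltr_pdivrMr//; move: nN CE0 k0; lra.
have nCh : n%:R * (C * h ^+ 2) = C * h.
  by rewrite expr2 mulrCA [n%:R * (h * h)]mulrA nh mul1r.
have pos : 0 < m * (1 - k * h) ^+ n - n%:R * (C * h ^+ 2).
  rewrite nCh subr_gt0; apply: lt_le_trans CE _; rewrite /E.
  by apply: ler_wpM2l; [exact: ltW|exact: aE].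
exists (m * (1 - k * h) ^+ n - n%:R * (C * h ^+ 2)) => //.
have -> : z 1 = (fun i : nat => z (i%:R * h)) n by rewrite /= nh.
apply: (@euler_invariance (fun i : nat => z (i%:R * h)) k m h C n) => //.
- exact: ltW.
- by move: kh; lra.
- move=> i iN; rewrite -natr1 mulrDl mul1r; apply: hz; rewrite ?mulr_ge0 ?(ltW h0)//.
  by rewrite -[leRHS]nh -[X in _ + X]mul1r -mulrDl ler_pM2r// natr1 ler_nat.
- move=> i iN; apply: bz; rewrite mulr_ge0 ?(ltW h0)//=.
  by rewrite -[leRHS]nh ler_pM2r// ler_nat ltnW.
- by rewrite mul0r.
- exact: ltW.
Qed.

End Invariance.

(** * Exponentials and quadratic representations preserve the cone *)

Section ConeAutomorphisms.
Context {R : realType} {V : jbAlgType R}.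
Implicit Types (x y v w p q : V).

Local Notation e := (@junit R V).

Lemma GOmegaM (g h : bop V) : GOmega g -> GOmega h -> GOmega (g * h).
Proof.
move=> [ig gO] [ih hO]; split; first exact: bop_invertibleM.
by rewrite -{2}gO -{2}hO image_comp.
Qed.

(** The curve exp (s L_v) x solves z' = v o z. *)
Lemma exp_L_cone v x : jcone x -> jcone (bop_exp (L_ v) x).
Proof.
move=> /jconeP hx; apply/jconeP.
pose A := L_ v; pose a := `|A|.
pose k := a + expR a * `|x| + a ^+ 2 * expR a * (expR a * `|x|).
have a0 : 0 <= a by exact: normr_ge0.
have ex0 : 0 <= expR a * `|x| by rewrite mulr_ge0// expR_ge0.
have aex0 : 0 <= a ^+ 2 * expR a * (expR a * `|x|).
  by rewrite mulr_ge0// mulr_ge0 ?sqr_ge0 ?expR_ge0.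
have bz s : 0 <= s <= 1 -> `|bop_exp (s *: A) x| <= expR a * `|x|.
  move=> /andP[s0 s1]; rewrite (le_trans (bop_norm_ubound _ _))// ler_wpM2r//.
  by rewrite (le_trans (bop_exp_norm _))// ler_expR normrZ ger0_norm// ler_piMl.
have := @jbounded_below_flow R V (fun s => bop_exp (s *: A) x) k.
rewrite scale0r bop_exp0 scale1r; apply=> //.
  move=> s h s0 h0 sh; exists v; first by rewrite -L_norm /k -addrA lerDl addr_ge0.
  rewrite (_ : _ - _ - _ = (bop_exp (h *: A) - 1 - h *: A) (bop_exp (s *: A) x)).
    have h1 : h <= 1 by rewrite (le_trans _ sh)// lerDr.
    have s1 : s <= 1 by rewrite (le_trans _ sh)// lerDl.
    rewrite (le_trans (bop_norm_ubound _ _))//.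
    apply: (@le_trans _ _ (a ^+ 2 * expR a * h ^+ 2 * (expR a * `|x|))).
      apply: ler_pM => //; last by apply: bz; rewrite s0.
      rewrite (le_trans (bop_exp_taylor _))// normrZ (ger0_norm h0) exprMn.
      rewrite [leRHS]mulrC -mulrA ler_wpM2l ?sqr_ge0// ler_wpM2l ?sqr_ge0//.
      by rewrite ler_expR ler_piMl.
    by rewrite mulrAC ler_wpM2r ?sqr_ge0// /k lerDr addr_ge0.
  by rewrite (addrC s) bop_expD !bopB bopZ.
move=> s /bz/le_trans; apply; rewrite /k -addrA addrCA lerDl addr_ge0//.
Qed.

Lemma exp_L_GOmega v : GOmega (bop_exp (L_ v)).
Proof.
split; first by exists (bop_exp (- L_ v)); exact: bop_exp_is_inverse.
apply/seteqP; split=> [_ [x hx <-]|x hx]; first exact: exp_L_cone.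
exists (bop_exp (L_ (- v)) x); first exact: exp_L_cone.
by rewrite L_N -[LHS]/((bop_exp (L_ v) * bop_exp (- L_ v)) x) bop_expK.
Qed.

Lemma U_segment q s : U_ (e + s *: q) = 1 + (2 * s) *: L_ q + s ^+ 2 *: U_ q.
Proof.
apply: bopP => y; rewrite /U_ !bopD !bopZ !bopB !bopN !bopZ /= !expr2 /=.
rewrite !(jmulDl, jmulDr, jmulZl, jmulZr, jmul1, jmulr1).
by lmod R.
Qed.

(** Together with U_segment this says that s |-> U_(e + s q) has derivative
    2 L_(w s) U_(e + s q), where w s is the quotient of q by e + s q. For s <> 0 it is
    LU_inv, because s q = (e + s q) - e. *)
Lemma L_segment_inv q s (S : bop V) : bop_is_inverse (L_ (e + s *: q)) S ->
  GRing.comm (L_ (e + s *: q)) (L_ (S e)) ->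
  L_ (S q) * U_ (e + s *: q) = L_ q + s *: U_ q.
Proof.
move=> xS cS; have [s0|s0] := eqVneq s 0.
  move: xS cS; rewrite s0 !scale0r !addr0 L_unit => -[_ S1] _.
  rewrite (_ : S = 1); last by rewrite -[S]mulr1.
  have := U_segment 0 0; rewrite !scale0r !addr0 mulr0 scale0r expr0n scale0r.
  by rewrite !addr0 => ->; rewrite mulr1.
apply: (scalerI s0); rewrite -bopMZl -L_Z.
have -> : s *: S q = e - S e.
  have : S (e + s *: q) = e.
    by rewrite -[e + s *: q]jmulr1 -[LHS]/((S * L_ (e + s *: q)) e) xS.2.
  by rewrite bop_funD bop_funZ => E; rewrite -{1}E addrAC subrr add0r.
rewrite L_B mulrBl (LU_inv xS cS) L_unit mul1r U_segment L_D L_unit L_Z.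
by lmod R.
Qed.

(** Along the segment from e to p the curve U_(e + s q) y solves z' = w o z, with w
    bounded since the segment is uniformly bounded below. The error is exactly
    h^2 U_q y, and h may have either sign. *)
Lemma U_flow q y p : p = e + q -> jcone p ->
  exists2 k, 0 <= k & forall s h, 0 <= s <= 1 -> 0 <= s + h <= 1 ->
   [/\ `|U_ (e + s *: q) y| <= k & exists2 w, `|w| <= k &
    `|U_ (e + (s + h) *: q) y - U_ (e + s *: q) y
        - h *: (w ** (U_ (e + s *: q) y))| <= k * h ^+ 2].
Proof.
move=> pE /jconeP[d d0 pd].
pose d' := Num.min d 1.
have d'0 : 0 < d' by rewrite lt_min d0 ltr01.
have seg s : 0 <= s <= 1 -> jpos (e + s *: q - d' *: e).
  move=> /andP[s0 s1].
  have c1 : 0 <= (1 - s) * (1 - d') by rewrite mulr_ge0// subr_ge0// ge_min lexx orbT.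
  have c2 : 0 <= s * (d - d') by rewrite mulr_ge0// subr_ge0 ge_min lexx.
  have := jposD (jposD (jpos_unit c1) (jpos_unit c2)) (jposZ s0 pd).
  by rewrite pE; congr jpos; lmod R.
pose k1 := 2 * (d'^-1 * `|q|).
pose k2 := `|y| + 2 * `|q ** y| + `|U_ q y|.
have k10 : 0 <= k1 by rewrite !mulr_ge0// invr_ge0 ltW.
have k20 : `|U_ q y| <= k2 by rewrite lerDr addr_ge0// mulr_ge0.
have k200 : 0 <= k2 by rewrite (le_trans _ k20).
exists (k1 + k2); first by rewrite addr_ge0.
move=> s h s01 sh01; split.
  move: s01 => /andP[s0 s1].
  rewrite U_segment !bopD !bopZ (le_trans (ler_normD _ _))//.
  rewrite (@le_trans _ _ k2)// ?lerDr//.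
  rewrite lerD//; last first.
    by rewrite normrZ ger0_norm ?sqr_ge0// ler_piMl// exprn_ile1.
  rewrite (le_trans (ler_normD _ _))// lerD2l normrZ ger0_norm ?mulr_ge0//.
  by rewrite -mulrA ler_wpM2l// ler_piMl.
have [S [xS nS cS]] := L_inverse d'0 (seg s s01).
exists (2 *: S q).
  rewrite normrZ ger0_norm// (@le_trans _ _ k1)// ?lerDl// ler_wpM2l//.
  by rewrite (le_trans (bop_norm_ubound _ _))// ler_wpM2r.
rewrite jmulZl -[S q ** _]/((L_ (S q) * U_ (e + s *: q)) y) L_segment_inv//.
rewrite (_ : _ - _ - _ = h ^+ 2 *: U_ q y); last first.
  by rewrite !U_segment; move: (U_ q) => W; rewrite !bopD !bopZ; lmod R.
rewrite normrZ ger0_norm ?sqr_ge0// mulrC ler_wpM2r ?sqr_ge0//.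
by rewrite (le_trans k20)// lerDr.
Qed.

(** The flow of U_flow is run backwards for one implication and forwards for the
    other. *)
Lemma U_cone p y : jcone p -> (jcone (U_ p y) <-> jcone y).
Proof.
move=> hp; pose q := p - e; have pE : p = e + q by rewrite /q addrC subrK.
have [k k0 hk] := U_flow y pE hp.
pose z s := U_ (e + s *: q) y.
have z0 : z 0 = y.
  by rewrite /z U_segment mulr0 !scale0r expr0n scale0r !addr0.
have z1 : z 1 = U_ p y by rewrite /z scale1r -pE.
split=> /jconeP h; apply/jconeP.
  have := @jbounded_below_flow _ _ (fun s => z (1 - s)) k.
  rewrite subrr z0 subr0 z1; apply=> //.
  - move=> s t s0 t0 st1.
    have [||_ [w wk hw]] := hk (1 - s) (- t); [by lra|by lra|].
    exists (- w); first by rewrite normrN.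
    rewrite (_ : 1 - (s + t) = 1 - s + - t); last by rewrite opprD addrA.
    by rewrite jmulNl scalerN; move: hw; rewrite sqrrN scaleNr.
  - by move=> s s01; have [||//] := hk (1 - s) 0; lra.
have := @jbounded_below_flow _ _ z k; rewrite z0 z1; apply=> //.
- move=> s t s0 t0 st1.
  by have [||_ hw] := hk s t; [lra|lra|exact: hw].
- by move=> s s01; have [||//] := hk s 0; lra.
Qed.

Lemma U_GOmega p : jcone p -> GOmega (U_ p).
Proof.
move=> hp; have iU : bop_invertible (U_ p).
  have /jconeP[d d0 pd] := hp; have [S [xS _ cS]] := L_inverse d0 pd.
  exact: (U_invertible xS cS).
split=> //; apply/seteqP; split=> [_ [x hx <-]|x hx]; first exact/U_cone.
have [S [US _]] := iU.
have USx : U_ p (S x) = x by rewrite -[LHS]/((U_ p * S) x) US.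
by exists (S x) => //; apply/(U_cone _ hp); rewrite USx.
Qed.

End ConeAutomorphisms.

(** * The geodesic and its length *)

Section Geodesic.
Context {R : realType} {V : jbAlgType R}.
Implicit Types (p v : V) (g A P : bop V).

Lemma is_derive_bop_expM P A Q (t : R) :
  is_derive t 1 (fun s => P * bop_exp (s *: A) * Q) (P * bop_exp (t *: A) * A * Q).
Proof.
apply: (@is_derive_of_quadratic _ _ _ _
  (`|P| * (expR (`|t| * `|A|) * (`|A| ^+ 2 * expR `|A|)) * `|Q|)) => h h1.
rewrite (_ : _ - _ - _ = P * (bop_exp ((t + h) *: A) - bop_exp (t *: A) -
    h *: (bop_exp (t *: A) * A)) * Q); last first.
  by rewrite !mulrBr bopMZr !mulrBl bopMZl !mulrA.
rewrite (le_trans (bop_normM _ _))// mulrAC ler_wpM2r//.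
rewrite (le_trans (bop_normM _ _))// -mulrA ler_wpM2l//.
exact: bop_exp_step.
Qed.

Lemma derive1_bop_expM P A Q :
  (fun t : R => P * bop_exp (t *: A) * Q)^`() =
  fun t => P * bop_exp (t *: A) * A * Q.
Proof.
apply/funext => t; rewrite derive1E.
by have [_ ->] := is_derive_bop_expM P A Q t.
Qed.

Lemma bop_expM1 P A :
  (fun t : R => P * bop_exp (t *: A)) = (fun t : R => P * bop_exp (t *: A) * 1).
Proof. by apply/funext => t; rewrite mulr1. Qed.

Lemma speed_expM P A (t : R) : bop_invertible P ->
  speed (fun t : R => P * bop_exp (t *: A)) t = `|A|.
Proof.
move=> iP; rewrite /speed /finsler_norm bop_expM1 derive1_bop_expM !mulr1 mulrA.
have /bop_invP[_ ->] : bop_invertible (P * bop_exp (t *: A)).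
  apply: bop_invertibleM => //; exists (bop_exp (- (t *: A))).
  exact: bop_exp_is_inverse.
by rewrite mul1r.
Qed.

Lemma length_expM P A : bop_invertible P ->
  length_GOmega (fun t : R => P * bop_exp (t *: A)) = `|A|%:E.
Proof.
move=> iP; rewrite /length_GOmega.
under eq_integral do rewrite speed_expM//.
by rewrite integral_cst//= lebesgue_measure_itv/= lte01 oppr0 adde0 mule1.
Qed.

Lemma derivation0 : derivation (0 : bop V).
Proof. by move=> x y; rewrite jmul0l jmul0r addr0. Qed.

(** The velocity is the curve times L_v, without derivation part, so that the
    commutator terms of the spray cancel and the equation is alpha'' = alpha L_v^2. *)
Lemma spray_geodesic_exp (I : set R) g v : GOmega g ->
  spray_geodesic I (fun t : R => g * bop_exp (t *: L_ v)).
Proof.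
have dE : (fun t : R => g * bop_exp (t *: L_ v))^`() =
    fun t => g * bop_exp (t *: L_ v) * L_ v.
  rewrite bop_expM1 derive1_bop_expM.
  by apply/funext => t; rewrite mulr1.
move=> hg t _; split.
- by apply: GOmegaM => //; rewrite -L_Z; exact: exp_L_GOmega.
- near=> s; rewrite bop_expM1.
  by have [] := is_derive_bop_expM g (L_ v) 1 s.
- rewrite dE; have [dd _] := is_derive_bop_expM g (L_ v) (L_ v) t.
  exact: dd.
- exists v, 0; split; first exact: derivation0.
  + by rewrite dE addr0.
  + by rewrite dE /spray_value addr0 subr0 addrK derive1_bop_expM expr2 mulrA.
Unshelve. all: by end_near. Qed.

Lemma continuous_expM P A Q : continuous (fun t : R => P * bop_exp (t *: A) * Q).
Proof.
move=> t; have [d _] := is_derive_bop_expM P A Q t.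
by apply: differentiable_continuous; apply/derivable1_diffP.
Qed.

Lemma path_GOmega_exp g v : GOmega g ->
  path_GOmega (g * bop_exp (0 *: L_ v)) (g * bop_exp (1 *: L_ v))
    (fun t : R => g * bop_exp (t *: L_ v)).
Proof.
move=> hg; split=> //.
  by move=> t _; apply: GOmegaM => //; rewrite -L_Z; exact: exp_L_GOmega.
exists [:: 1]; first by apply: itv_partition1; exact: ltr01.
case=> // _; split=> /=.
  by rewrite bop_expM1; apply: continuous_subspaceT; exact: continuous_expM.
exists (fun t : R => g * bop_exp (t *: L_ v) * L_ v).
  by apply: continuous_subspaceT; exact: continuous_expM.
move=> t _; rewrite bop_expM1; split.
  by have [] := is_derive_bop_expM g (L_ v) 1 t.
by rewrite derive1_bop_expM mulr1.
Qed.

End Geodesic.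

(** * A mean value inequality for logarithms of norms *)

Section Dini.
Context {R : realType}.
Implicit Types (f s sigma : R -> R) (a b t : R).

(** If f y exceeded f x + d (y - x), consider the last t0 in [x, y] at which f lies below
    the line of slope d through (x, f x): the hypothesis at t0 yields a later one. *)
Lemma dini_le_open f a b : {in `]a, b[%R, continuous f} ->
  (forall t, a < t < b -> forall d, 0 < d ->
    \forall h \near 0^'+, f (t + h) <= f t + d * h) ->
  forall x y, a < x -> x < y -> y < b -> f y <= f x.
Proof.
move=> cf hf x y ax xy yb; apply/ler_addgt0Pl => d' d'0.
have xy0 : 0 < y - x by rewrite subr_gt0.
pose d := d' / (y - x); have d0 : 0 < d by rewrite divr_gt0.
pose M t := f t - f x - d * (t - x).
suff : M y <= 0.
  by rewrite /M /d divfK ?gt_eqF// subr_le0 lerBlDr addrC.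
rewrite leNgt; apply/negP => My.
pose S := [set t | x <= t <= y /\ M t <= 0].
have Sx : S x by split; rewrite ?lexx ?(ltW xy)// /M !subrr mulr0 subrr.
have Sub : ubound S y by move=> t [/andP[]].
have hS : has_sup S by split; [exists x|exists y].
pose t0 := sup S.
have xt0 : x <= t0 by apply: ub_le_sup => //; exists y.
have t0y : t0 <= y by apply: ge_sup => //; exists x.
have at0 : a < t0 by rewrite (lt_le_trans ax).
have t0b : t0 < b by rewrite (le_lt_trans t0y).
have cM : {for t0, continuous M}.
  apply: cvgB; first apply: cvgB; [|exact: cvg_cst|].
    by apply: cf; rewrite in_itv /= at0 t0b.
  by apply: cvgMr; apply: cvgB; [exact: cvg_id|exact: cvg_cst].
have Mt0 : M t0 <= 0.
  rewrite leNgt; apply/negP => Mp.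
  have /nbhs_ballP[r /= r0 rM] : \forall t \near t0, 0 < M t.
    exact: (cvgr_gt _ cM).
  have [t [tS tM] tr] := sup_adherent r0 hS.
  have : 0 < M t.
    apply: rM; rewrite /ball /= ger0_norm; last first.
      by rewrite subr_ge0; apply: ub_le_sup => //; exists y.
    by move: tr; rewrite -/t0; lra.
  by rewrite ltNge tM.
have t0y' : t0 < y.
  by rewrite lt_neqAle t0y andbT; apply/eqP => E; move: Mt0; rewrite E leNgt My.
have [h [h0 hy hM]] : exists h, [/\ 0 < h, t0 + h <= y & f (t0 + h) <= f t0 + d * h].
  have yt0 : 0 < y - t0 by rewrite subr_gt0.
  near (0 : R)^'+ => h; exists h; split.
  - by [].
  - by rewrite -lerBrDl; near: h; exact: nbhs_right_le.
  - by near: h; apply: hf => //; rewrite at0 t0b.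
have : S (t0 + h).
  split; first by rewrite hy andbT (le_trans xt0)// lerDl ltW.
  by move: Mt0 hM; rewrite /M; lra.
move/(ub_le_sup hS.2); rewrite -/t0; lra.
Unshelve. all: by end_near. Qed.

(** A continuous function whose upper right Dini derivative is nonpositive on the open
    interval decreases. This is the mean value argument for norms of curves, which
    need not be differentiable. *)
Lemma dini_le f a b : a < b -> {within `[a, b], continuous f} ->
  (forall t, a < t < b -> forall d, 0 < d ->
    \forall h \near 0^'+, f (t + h) <= f t + d * h) ->
  f b <= f a.
Proof.
move=> ab /(continuous_within_itvP _ ab)[cf fa fb] hf.
have mono := dini_le_open cf hf.
have fbx x : a < x -> x < b -> f b <= f x.
  move=> ax xb; apply: (cvgr_to_le fb); near=> y.
  have xy : x < y by near: y; exact: nbhs_left_gt.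
  have yb : y < b by near: y; exact: nbhs_left_lt.
  exact: mono.
apply: (cvgr_to_ge fa); near=> x.
have ax : a < x by near: x; exact: nbhs_right_gt.
have xb : x < b by near: x; exact: nbhs_right_lt.
exact: fbx.
Unshelve. all: by end_near. Qed.

Lemma ln_sub_le (x y : R) : 0 < x -> 0 < y -> ln y - ln x <= (y - x) / x.
Proof.
move=> x0 y0; rewrite -ln_div ?posrE//.
have -> : y / x = 1 + (y - x) / x by field; rewrite gt_eqF.
rewrite le_ln1Dx// mulrBl divff ?gt_eqF//.
by have := divr_gt0 y0 x0; lra.
Qed.

Lemma ln_lipschitz (x y u : R) : 0 < x -> u < 1 -> `|y - x| <= u * x ->
  `|ln y - ln x| <= u / (1 - u).
Proof.
move=> x0 u1 yx; have u0 : 0 <= u by rewrite -(pmulr_lge0 _ x0) (le_trans _ yx).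
have u1' : 0 < 1 - u by rewrite subr_gt0.
have yx' : (1 - u) * x <= y by move: yx; rewrite ler_norml; lra.
have y0 : 0 < y by rewrite (lt_le_trans _ yx')// mulr_gt0.
rewrite ler_norml; apply/andP; split.
  rewrite lerNl opprB (le_trans (ln_sub_le y0 x0))//.
  rewrite ler_pdivrMr// (@le_trans _ _ (u * x))//.
    by move: yx; rewrite ler_norml; lra.
  by rewrite -mulrA ler_wpM2l// ler_pdivlMl.
rewrite (le_trans (ln_sub_le x0 y0))//.
apply: (@le_trans _ _ u).
  by rewrite ler_pdivrMr// (le_trans (ler_norm _)).
by rewrite ler_pdivlMr// mulrBr mulr1 gerBl mulr_ge0.
Qed.

(** Bounding the logarithmic derivative of f by that of a primitive: dini_le applies to
    both ln f - sigma and - ln f - sigma. *)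
Lemma ln_dini f s sigma a b : a < b ->
  {within `[a, b], continuous f} -> {within `[a, b], continuous sigma} ->
  (forall t, a <= t <= b -> 0 < f t) ->
  (forall t, a < t < b -> 0 <= s t) ->
  (forall t, a < t < b -> is_derive t 1 sigma (s t)) ->
  (forall t, a < t < b -> forall d, 0 < d ->
    \forall h \near 0^'+, `|f (t + h) - f t| <= h * (s t + d) * f t) ->
  `|ln (f b) - ln (f a)| <= sigma b - sigma a.
Proof.
move=> ab cf cs f0 s0 ds hf.
have dsig t d : a < t < b -> 0 < d ->
    \forall h \near 0^'+, sigma t + h * (s t - d) <= sigma (t + h).
  move=> tab d0; have [dd dv] := ds t tab.
  have := dd; rewrite /derivable -/(derive _ _ _).
  move/cvg_dnbhs_at_right; rewrite -/(derive _ _ _) dv => /cvgrPdist_le/(_ _ d0) H.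
  near=> h; have h0 : 0 < h by [].
  have : `|s t - h^-1 *: (sigma (h *: 1 + t) - sigma t)| <= d by near: h.
  rewrite [h *: 1]mulr1 [h + t]addrC ler_norml => /andP[_].
  rewrite lerBlDr -lerBlDl [_ *: _]mulrC ler_pdivlMr//; lra.
have main (eps : R) : `|eps| = 1 -> eps * ln (f b) - sigma b <= eps * ln (f a) - sigma a.
  move=> eps1; apply: (@dini_le (fun t => eps * ln (f t) - sigma t) a b) => //.
    apply: within_continuousB => //.
    apply: (@within_continuous_comp _ _ _ _ f (fun y => eps * ln y)) => //.
    move=> y; rewrite inE => -[t /= tab <-].
    by apply: cvgMr; apply: continuous_ln; apply: f0; rewrite in_itv in tab.
  move=> t tab d d0; pose d1 := d / 3; have d10 : 0 < d1 by rewrite divr_gt0.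
  have st0 := s0 t tab.
  have ft0 : 0 < f t by apply: f0; case/andP: tab => *; rewrite !ltW.
  have H1 := hf t tab d1 d10; have H2 := dsig t d1 tab d10.
  near=> h; have h0 : 0 < h by [].
  have h1 : `|f (t + h) - f t| <= h * (s t + d1) * f t by near: h.
  have h2 : sigma t + h * (s t - d1) <= sigma (t + h) by near: h.
  have h3 : h <= d1 / ((s t + d1) * (s t + 2 * d1)).
    near: h; apply: nbhs_right_le; rewrite divr_gt0// mulr_gt0//; lra.
  have u2 : h * (s t + d1) * (s t + 2 * d1) <= d1.
    by rewrite -mulrA -ler_pdivlMr// mulr_gt0//; lra.
  have u1 : h * (s t + d1) < 1.
    have : h * (s t + d1) * (2 * d1) <= d1.
      rewrite (le_trans _ u2)// ler_wpM2l ?mulr_ge0//; lra.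
    rewrite mulrA -[leRHS]mul1r ler_pM2r//; lra.
  have := ln_lipschitz ft0 u1 h1 => h4.
  have h5 : h * (s t + d1) / (1 - h * (s t + d1)) <= h * (s t + 2 * d1).
    rewrite ler_pdivrMr ?subr_gt0// -mulrA ler_wpM2l ?(ltW h0)//.
    by move: u2; lra.
  have h6 : eps * (ln (f (t + h)) - ln (f t)) <= `|ln (f (t + h)) - ln (f t)|.
    by rewrite (le_trans (ler_norm _))// normrM eps1 mul1r.
  have : d = 3 * d1 by rewrite /d1 mulrC divfK.
  move: h2 h4 h5 h6; move: (ln _) (ln _) `|_| => *; nra.
rewrite ler_norml; apply/andP; split.
  by have := main (-1); rewrite normrN1 => /(_ erefl); rewrite !mulN1r; lra.
by have := main 1; rewrite normr1 => /(_ erefl); rewrite !mul1r; lra.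
Unshelve. all: by end_near. Qed.

End Dini.

(** * Variation of norms along curves *)

Section CurveLength.
Context {R : realType} {V : jbAlgType R}.
Implicit Types (alpha : R -> bop V) (c : bop V) (a b t : R).

(** Write c (alpha (t + h) - alpha t) as c alpha t times the inverse of alpha t times the
    increment; the last two factors, divided by h, tend to the velocity pulled back
    to the identity, whose norm is the speed. *)
Lemma norm_curve_dini alpha c t : derivable alpha t 1 -> bop_invertible (alpha t) ->
  forall d, 0 < d -> \forall h \near 0^'+,
    `| `|c * alpha (t + h)| - `|c * alpha t| | <= h * (speed alpha t + d) * `|c * alpha t|.
Proof.
move=> dd iat d d0; have [inv2 _] := bop_invP iat.
have H : (fun h : R => bop_inv (alpha t) * (h^-1 *: (alpha (h *: 1 + t) - alpha t)))
    @ 0^'+ --> bop_inv (alpha t) * derive1 alpha t.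
  apply: bop_mul_cvgl; apply: cvg_dnbhs_at_right; rewrite derive1E.
  exact: dd.
have {}H := cvgr_norm_le _ H.
have : `|bop_inv (alpha t) * derive1 alpha t| < speed alpha t + d.
  by rewrite -[X in X < _]/(speed alpha t) ltrDl.
move/H => {}H; near=> h; have h0 : 0 < h by [].
have : `|bop_inv (alpha t) * (h^-1 *: (alpha (h *: 1 + t) - alpha t))| <=
  speed alpha t + d by near: h.
rewrite bopMZr normrZ normfV gtr0_norm// ler_pdivrMl// [h *: 1]mulr1 [h + t]addrC => hh.
rewrite (le_trans (ler_dist_dist _ _))// -mulrBr.
rewrite (_ : c * (alpha (t + h) - alpha t) =
    c * alpha t * (bop_inv (alpha t) * (alpha (t + h) - alpha t))).
  by rewrite (le_trans (bop_normM _ _))// [leRHS]mulrC ler_wpM2l.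
by rewrite -mulrA (mulrA (alpha t)) inv2 mul1r.
Unshelve. all: by end_near. Qed.

(** On a C^1 piece the speed agrees inside the interval with a continuous function g,
    whose primitive serves as sigma in ln_dini. *)
Lemma curve_piece alpha c a b : a < b -> C1_on a b alpha ->
  (forall t, a <= t <= b -> bop_invertible (alpha t)) ->
  (forall t, a <= t <= b -> 0 < `|c * alpha t|) ->
  measurable_fun `[a, b] (speed alpha) /\
  (`|ln `|c * alpha b| - ln `|c * alpha a| |%:E <=
    \int[lebesgue_measure]_(t in `[a, b]) (speed alpha t)%:E)%E.
Proof.
move=> ab [ca [beta cb dab]] ia pos.
have {}dab t : a < t < b -> derivable alpha t 1 /\ derive1 alpha t = beta t.
  by move=> tab; apply: dab; rewrite inE /= in_itv.
pose g t := `|bop_inv (alpha t) * beta t|.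
have cg : {within `[a, b], continuous g}.
  have ci : {within `[a, b], continuous (fun t => bop_inv (alpha t))}.
    apply: (@within_continuous_comp _ _ _ _ alpha bop_inv) => //.
    move=> y; rewrite inE => -[t /= tab <-].
    by apply: bop_inv_continuous; apply: ia; rewrite in_itv in tab.
  move=> t; apply: cvg_norm; apply: bop_mul_cvg; [exact: ci|exact: cb].
have gE t : a < t < b -> speed alpha t = g t.
  move=> tab; rewrite /speed /finsler_norm /g.
  by have [_ ->] := dab t tab.
have mg : measurable_fun `[a, b] g.
  by apply: subspace_continuous_measurable_fun => //; exact: measurable_itv.
have mgo : measurable_fun `]a, b[ g.
  apply: measurable_funS mg; first exact: measurable_itv.
  by apply: subset_itv_oo_cc.
have mso : measurable_fun `]a, b[ (speed alpha).
  apply: eq_measurable_fun mgo => t; rewrite inE/= in_itv/= => tab.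
  by rewrite gE.
split.
  by apply/measurable_fun_itv_bndo_bndcP/measurable_fun_itv_obnd_cbndP.
rewrite (@eq_integral_itv_bounded _ _ _ g)//.
have intg : lebesgue_measure.-integrable `[a, b] (EFin \o g).
  by apply: continuous_compact_integrable => //; exact: segment_compact.
pose sigma t := parameterized_integral lebesgue_measure a t g.
have csig : {within `[a, b], continuous sigma}.
  by apply: parameterized_integral_continuous => //; exact: ltW.
have : `|ln `|c * alpha b| - ln `|c * alpha a| | <= sigma b - sigma a.
  apply: (@ln_dini _ (fun t => `|c * alpha t|) g) => //.
  - by move=> t; apply: cvg_norm; apply: bop_mul_cvgl; exact: ca.
  - by move=> t _; exact: normr_ge0.
  - move=> t tab; have /andP[at_ tb] := tab.
    have [||||dd dv] := @continuous_FTC1 R g (BLeft a) t b => //.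
      by apply: (within_continuous_continuous ab cg); rewrite in_itv.
    have dv' : 'D_1 sigma t = g t by rewrite -derive1E.
    exact: DeriveDef dd dv'.
  - move=> t tab d d0; rewrite -gE//; apply: norm_curve_dini => //.
      by have [] := dab t tab.
    by apply: ia; case/andP: tab => *; rewrite !ltW.
rewrite {2}/sigma /parameterized_integral set_itv1 Rintegral_set1 subr0.
rewrite /sigma /parameterized_integral /Rintegral -lee_fin fineK//.
exact: integrable_fin_num.
Qed.

(** Additivity of the integral over the pieces. Measurability of the speed is carried
    along because the integral is split on it. *)
Lemma curve_length alpha c a b s : itv_partition a b s ->
  (forall i, (i < size s)%N -> C1_on (nth b (a :: s) i) (nth b s i) alpha) ->
  (forall t, a <= t <= b -> bop_invertible (alpha t)) ->
  (forall t, a <= t <= b -> 0 < `|c * alpha t|) ->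
  measurable_fun `[a, b] (speed alpha) /\
  (`|ln `|c * alpha b| - ln `|c * alpha a| |%:E <=
    \int[lebesgue_measure]_(t in `[a, b]) (speed alpha t)%:E)%E.
Proof.
elim: s a => [|x s ih] a /= ps C1 ia pos.
  rewrite -(itv_partition_nil ps) subrr normr0 set_itv1; split.
    exact: measurable_fun_set1.
  by rewrite integral_set1.
have ax : a < x by case: ps => /= /andP[].
have xb : x <= b := itv_partition_le (itv_partition_cons ps).
have [|t /andP[at_ tx]|t /andP[at_ tx]|m1 l1] := @curve_piece alpha c a x ax.
- exact: (C1 0%N).
- by apply: ia; rewrite at_ (le_trans tx).
- by apply: pos; rewrite at_ (le_trans tx).
have [i|t /andP[xt tb]|t /andP[xt tb]|m2 l2] := ih x (itv_partition_cons ps).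
- exact: (C1 i.+1).
- by apply: ia; rewrite tb (le_trans (ltW ax)).
- by apply: pos; rewrite tb (le_trans (ltW ax)).
have m1o : measurable_fun `[a, x[ (speed alpha).
  apply: measurable_funS m1; first exact: measurable_itv.
  exact: subset_itv_co_cc.
have UE : `[a, b] = `[a, x[ `|` `[x, b] :> set R.
  by rewrite (@itv_bndbnd_setU _ _ _ (BLeft x))// bnd_simp ltW.
have mab : measurable_fun `[a, b] (speed alpha).
  rewrite UE; apply/measurable_funU; [exact: measurable_itv|exact: measurable_itv|].
  by split.
split=> //.
have -> : (\int[lebesgue_measure]_(t in `[a, b]) (speed alpha t)%:E =
    \int[lebesgue_measure]_(t in `[a, x]) (speed alpha t)%:E +
    \int[lebesgue_measure]_(t in `[x, b]) (speed alpha t)%:E)%E.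
  rewrite UE ge0_integral_setU//=; last 3 first.
  - by rewrite -UE; exact/measurable_EFinP.
  - by move=> t _; rewrite lee_fin; exact: normr_ge0.
  - apply/disj_setPS => t [/=]; rewrite !in_itv/= => /andP[_ tx] /andP[xt _].
    by move: (lt_le_trans tx xt); rewrite ltxx.
  by rewrite integral_itv_bndo_bndc//; exact/measurable_EFinP.
apply: (le_trans _ (leeD l1 l2)); rewrite -EFinD lee_fin.
by rewrite -[X in `|X|](subrKA (ln `|c * alpha x|)) addrC ler_normD.
Qed.

End CurveLength.

(** * Lower bound for the length *)

Section NormBound.
Context {R : realType} {V : jbAlgType R}.
Implicit Types (v x : V).

Local Notation e := (@junit R V).

Lemma jpow_addn v m n : jpow v (n + m) = (L_ v ^+ n) (jpow v m).
Proof. by rewrite /jpow exprD. Qed.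

(** For exponents 2^j this is the axiom on the norm of squares; for m, write
    2^m = (2^m - m) + m and compare with the trivial upper bounds. *)
Lemma jpow_norm v m : e != 0 -> `|jpow v m| = `|v| ^+ m.
Proof.
move=> e0; have e1 : `|e| = 1 by apply: junit_norm; rewrite normr_gt0.
have iter_le n x : `|(L_ v ^+ n) x| <= `|v| ^+ n * `|x|.
  rewrite (le_trans (bop_norm_ubound _ _))// ler_wpM2r//.
  by rewrite (le_trans (bop_normX _ _))// L_norm.
have pow2 j : `|jpow v (2 ^ j)| = `|v| ^+ (2 ^ j).
  elim: j => [|j ih]; first by rewrite expn0 jpow1 expr1.
  by rewrite expnS mul2n -addnn -jpowD jmul_norm_sqr ih -exprM muln2 -addnn.
have [v0|v0] := eqVneq `|v| 0.
  case: m => [|m]; first by rewrite jpow0 expr0.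
  by rewrite jpowS (normr0_eq0 v0) jmul0l normr0 expr0n.
apply/le_anti; rewrite -{1}[jpow v m]/((L_ v ^+ m) e).
rewrite (le_trans (iter_le _ _)) ?e1 ?mulr1//=.
have m2 : (m <= 2 ^ m)%N by rewrite ltnW// ltn_expl.
have := iter_le (2 ^ m - m)%N (jpow v m); rewrite -jpow_addn subnK// pow2.
rewrite -{1}(subnK m2) exprD ler_pM2l// exprn_gt0// lt_neqAle eq_sym v0.
exact: normr_ge0.
Qed.

(** The coefficients of exp (s x) + exp (- s x): they vanish for odd k. *)
Definition cosh_coeff (s : R) (k : nat) : R := s ^+ k / k`!%:R + (- s) ^+ k / k`!%:R.

Lemma cosh_coeff_jpos s v k : jpos (cosh_coeff s k *: jpow v k).
Proof.
rewrite /cosh_coeff -mulrDl exprNn; case: (boolP (odd k)) => ok.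
  by rewrite -signr_odd ok expr1 mulN1r subrr mul0r scale0r; exact: jpos0.
rewrite -signr_odd (negbTE ok) expr0 mul1r; apply: jposZ.
  rewrite divr_ge0// -[k](odd_double_half k) (negbTE ok) add0n -mul2n exprM.
  by rewrite addr_ge0// exprn_ge0// sqr_ge0.
rewrite -[k](odd_double_half k) (negbTE ok) add0n -addnn -jpowD.
exact: jpos_sq.
Qed.

(** All terms of the series of 2 cosh (s v) are positive, since even powers are squares;
    hence each term is dominated by the sum, also in norm. *)
Lemma cosh_term_le v s m :
  `|cosh_coeff s m *: jpow v m| <=
  `|bop_exp (s *: L_ v)| + `|bop_exp ((- s) *: L_ v)|.
Proof.
pose c := (bop_exp (s *: L_ v) + bop_exp ((- s) *: L_ v)) e.
apply: (@le_trans _ _ `|c|); last first.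
  rewrite (le_trans (bop_norm_ubound _ _))//.
  by rewrite (le_trans (ler_piMr _ junit_norm_le1))// ler_normD.
apply: jpos_mono; first exact: cosh_coeff_jpos.
pose u N := (exp_trunc (fun k => L_ v ^+ k) s N +
             exp_trunc (fun k => L_ v ^+ k) (- s) N) e.
have uE N : u N = \sum_(0 <= k < N) cosh_coeff s k *: jpow v k.
  rewrite /u /exp_trunc -big_split /= bop_sum; apply: eq_bigr => k _.
  by rewrite -scalerDl bopZ.
have uc : u @ \oo --> c.
  by apply: bop_eval_cvg; apply: cvgD; exact: bop_expZ_cvg.
apply: jpos_closed => d d0; move/cvgrPdist_le : uc => /(_ _ d0)[N _ hN].
pose n := maxn N m.+1.
exists (u n - cosh_coeff s m *: jpow v m); last first.
  rewrite opprB addrA subrK; apply: hN => /=; exact: leq_maxl.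
have mn : (m < n)%N by exact: leq_maxr.
rewrite uE (big_cat_nat (n := m))//= 1?ltnW// [X in _ + X - _]big_ltn//.
set t := cosh_coeff s m *: _; set S1 := \sum_(0 <= k < m) _.
set S2 := \sum_(m.+1 <= k < n) _.
rewrite (_ : S1 + (t + S2) - t = S1 + S2); last by lmod R.
rewrite /S1 /S2.
by apply: jposD; apply: (big_ind jpos) => [|x y|k _];
  [exact: jpos0|exact: jposD|exact: cosh_coeff_jpos
  |exact: jpos0|exact: jposD|exact: cosh_coeff_jpos].
Qed.

(** If r < M choose th < 1 with r < th M. Multiplying the m-th bound by th^m and summing
    over m gives exp (n th M) <= 2 exp (n r) / (1 - th) for all n, which is absurd. *)
Lemma le_of_exp_coeff_bound (M r : R) : 0 <= r ->
  (forall n m : nat, exp_coeff (n%:R * M) m + exp_coeff (- (n%:R * M)) m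
     <= 2 * expR (n%:R * r)) -> M <= r.
Proof.
move=> r0 h; rewrite leNgt; apply/negP => rM.
have M0 : 0 < M by rewrite (le_lt_trans r0).
pose th := (1 + r / M) / 2.
have rM1 : r / M < 1 by rewrite ltr_pdivrMr// mul1r.
have rM0 : 0 <= r / M by rewrite divr_ge0// ltW.
have th0 : 0 < th by rewrite /th; lra.
have th1 : th < 1 by rewrite /th; lra.
have thM : 0 < th * M - r.
  have -> : th * M - r = (M - r) / 2 by rewrite /th; field; rewrite gt_eqF.
  by rewrite divr_gt0// subr_gt0.
pose K := 2 / (1 - th); have K0 : 0 < K by rewrite divr_gt0// subr_gt0.
have bound (n : nat) : expR (n%:R * (th * M)) <= K * expR (n%:R * r).
  have cvg1 (y : R) : series (exp_coeff y) @ \oo --> expR y.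
    exact: is_cvg_series_exp_coeff.
  have H : (fun N => series (exp_coeff (n%:R * (th * M))) N +
      series (exp_coeff (- (n%:R * (th * M)))) N) @ \oo -->
      expR (n%:R * (th * M)) + expR (- (n%:R * (th * M))).
    by apply: cvgD; exact: cvg1.
  have {H} : expR (n%:R * (th * M)) + expR (- (n%:R * (th * M))) <= K * expR (n%:R * r).
    apply: (cvgr_to_le H); apply: nearW => N; rewrite /series /= -big_split/=.
    apply: (@le_trans _ _ (2 * expR (n%:R * r) * series (geometric 1 th) N)).
      rewrite /series /= mulr_sumr; apply: ler_sum => k _.
      rewrite /geometric /= mul1r.
      rewrite (_ : _ + _ = th ^+ k * (exp_coeff (n%:R * M) k +
                                     exp_coeff (- (n%:R * M)) k)); last first.
        by rewrite /exp_coeff /= (mulrCA n%:R th) -mulrN !(exprMn k th) mulrDr !mulrA.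
      by rewrite [leRHS]mulrC ler_wpM2l// exprn_ge0// ltW.
    rewrite geometric_seriesE ?lt_eqF//= mul1r /K mulrAC mulrA.
    rewrite ler_wpM2r ?expR_ge0// -mulrA ler_wpM2l// -[leRHS]mul1r.
    apply: ler_wpM2r; first by rewrite invr_ge0 subr_ge0 ltW.
    by rewrite gerBl exprn_ge0// ltW.
  by apply: le_trans; rewrite lerDl expR_ge0.
have lin (n : nat) : n%:R * (th * M - r) <= K.
  rewrite (@le_trans _ _ (1 + n%:R * (th * M - r)))// ?lerDr//.
  rewrite (le_trans (expR_ge1Dx _))// mulrBr expRD expRN ler_pdivrMr ?expR_gt0//.
have := lin (Num.bound (K / (th * M - r))).
rewrite -ler_pdivlMr// leNgt => /negP; apply.
by apply: archi_boundP; rewrite divr_ge0// ltW.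
Qed.

(** The converse of the estimate |exp A| <= exp |A|, special to multiplication operators.
    Taking n-th powers of the hypotheses gives the exponential bounds on the
    terms of 2 cosh (n v) required by le_of_exp_coeff_bound. *)
Lemma norm_le_of_exp v r : e != 0 -> 0 <= r ->
  `|bop_exp (L_ v)| <= expR r -> `|bop_exp (- L_ v)| <= expR r -> `|v| <= r.
Proof.
move=> e0 r0 h1 h2; apply: le_of_exp_coeff_bound => // n m.
have powle (A : bop V) : `|bop_exp A| <= expR r ->
    `|bop_exp (n%:R *: A)| <= expR (n%:R * r).
  move=> hA; rewrite bop_exp_natZ (le_trans (bop_normX _ _))// expRM_natl.
  by rewrite lerXn2r ?nnegrE ?expR_ge0.
have := cosh_term_le v n%:R m; rewrite scaleNr -scalerN => h.
apply: (@le_trans _ _ `|cosh_coeff n%:R m *: jpow v m|).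
  rewrite normrZ jpow_norm// (_ : _ + _ = cosh_coeff n%:R m * `|v| ^+ m).
    by rewrite ler_wpM2r ?exprn_ge0// ler_norm.
  rewrite /cosh_coeff /exp_coeff /= -mulNr !(exprMn m) mulrDl.
  by congr (_ + _); rewrite mulrAC.
rewrite (le_trans h)// mulrDl !mul1r lerD// powle//.
Qed.

Lemma norm_bop1 : e != 0 -> `|1 : bop V| = 1.
Proof. by move=> e0; rewrite -L_unit L_norm junit_norm ?normr_gt0. Qed.

Lemma bop_invertible_norm (T : bop V) : e != 0 -> bop_invertible T -> 0 < `|T|.
Proof.
move=> e0 [S [TS _]]; rewrite normr_gt0; apply/eqP => T0.
by have := norm_bop1 e0; rewrite -TS T0 mul0r normr0 => /eqP; rewrite eq_sym oner_eq0.
Qed.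

(** By curve_length, ln |c alpha| varies by at most the length of alpha. With c the inverse
    of the starting point this bounds |exp (L_v)|, with c the inverse of the end
    point it bounds |exp (- L_v)|; then norm_le_of_exp concludes. *)
Lemma path_length_ge (g : bop V) v (alpha : R -> bop V) : GOmega g ->
  path_GOmega g (g * bop_exp (L_ v)) alpha -> (`|v|%:E <= length_GOmega alpha)%E.
Proof.
move=> [ig _] [aO [s ps C1] a0 a1].
have len0 : (0 <= length_GOmega alpha)%E.
  by apply: integral_ge0 => t _; rewrite lee_fin; exact: normr_ge0.
have [e0|e0] := eqVneq e 0.
  by rewrite (junit_eq0 e0 v) normr0.
have ia t : 0 <= t <= 1 -> bop_invertible (alpha t).
  by move=> t01; have [] : GOmega (alpha t) by apply: aO; rewrite inE /= in_itv.
have key c : bop_invertible c -> (`|ln `|c * alpha 1| - ln `|c * alpha 0| |%:E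
    <= length_GOmega alpha)%E.
  move=> ic; have [||] // := @curve_length _ _ alpha c 0 1 s ps C1.
  move=> t t01; apply: bop_invertible_norm => //.
  by apply: bop_invertibleM => //; exact: ia.
have [g' [gg' g'g]] := ig.
have ig' : bop_invertible g' by exists g.
have iexp : bop_invertible (bop_exp (- L_ v)).
  have [h1 h2] := bop_exp_is_inverse (L_ v).
  by exists (bop_exp (L_ v)); split; [exact: h2|exact: h1].
have iexp' : bop_invertible (bop_exp (L_ v)).
  by exists (bop_exp (- L_ v)); exact: bop_exp_is_inverse.
have := key g' ig'; rewrite a0 a1 mulrA g'g mul1r (norm_bop1 e0) ln1 subr0 => k1.
have := key _ (bop_invertibleM iexp ig').
rewrite a0 a1 -!mulrA (mulrA g' g) g'g mul1r mulr1.
rewrite (bop_exp_is_inverse (L_ v)).2 (norm_bop1 e0) ln1 sub0r normrN => k2.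
case: (length_GOmega alpha) len0 k1 k2 => [l| |]; last 2 first.
- by move=> *; exact: leey.
- by rewrite leeNy_eq.
move=> l0 k1 k2; have expE (A : bop V) :
    bop_invertible A -> (`|ln `|A| |%:E <= l%:E)%E -> `|A| <= expR l.
  move=> iA; rewrite lee_fin => hA.
  rewrite -[X in X <= _]lnK ?posrE ?bop_invertible_norm//.
  by rewrite ler_expR (le_trans (ler_norm _)).
rewrite lee_fin; rewrite lee_fin in l0.
exact: norm_le_of_exp e0 l0 (expE _ iexp' k1) (expE _ iexp k2).
Qed.

End NormBound.

Theorem corollary5p16 (R : realType) (V : jbAlgType R) (p v : V)
    (hp : jcone p) :
  let Lambda := fun t : R => U_ p * bop_exp (t *: L_ v) in
  [/\ spray_geodesic `[0, 1] Lambda,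
      length_GOmega Lambda = `|L_ v|%:E,
      `|L_ v| = `|v|,
      `|v|%:E = dist_GOmega (Lambda 0) (Lambda 1) &
      dist_GOmega (Lambda 0) (Lambda 1) =
        dist_GOmega (U_ p) (U_ p * bop_exp (L_ v))].
Proof.
move=> Lambda; have gU := U_GOmega hp; have [iU _] := gU.
have lenL : length_GOmega Lambda = `|L_ v|%:E by exact: length_expM.
have L0 : Lambda 0 = U_ p by rewrite /Lambda scale0r bop_exp0 mulr1.
have L1 : Lambda 1 = U_ p * bop_exp (L_ v) by rewrite /Lambda scale1r.
split; [exact: spray_geodesic_exp|exact: lenL|exact: L_norm| |by rewrite L0 L1].
apply/eqP; rewrite eq_le; apply/andP; split.
  apply: le_ereal_inf_tmp => _ [alpha halpha <-].
  by move: halpha; rewrite L0 L1; exact: path_length_ge.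
apply: ereal_inf_lbound; exists Lambda; first exact: path_GOmega_exp.
by rewrite lenL L_norm.
Qed.
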